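(* Let $0<\alpha<1$ and $1<p<\frac1\alpha$, and fix a sign $\pm$. Then there exists a constant $C>0$ such that for any $u\in L^1(\mathbb{R})\cap{}^{\pm}W^{\alpha,p}(\mathbb{R})$, $$\|u\|_{L^{p^*}(\mathbb{R})}\le C\,\|{}^{\pm}\mathcal{D}^{\alpha}u\|_{L^p(\mathbb{R})},\qquad p^*:=\frac{p}{1-\alpha p}.$$
   Context: Fractional integrals on $\mathbb{R}$, for $\sigma>0$: ${}^{-}I^{\sigma}f(x)=\frac{1}{\Gamma(\sigma)}\int_{-\infty}^x\frac{f(y)}{(x-y)^{1-\sigma}}\,dy$ and ${}^{+}I^{\sigma}f(x)=\frac{1}{\Gamma(\sigma)}\int_x^\infty\frac{f(y)}{(y-x)^{1-\sigma}}\,dy$. For $0<\alpha<1$: ${}^{-}D^{\alpha}\varphi=\frac{d}{dx}\,{}^{-}I^{1-\alpha}\varphi$ and ${}^{+}D^{\alpha}\varphi=-\frac{d}{dx}\,{}^{+}I^{1-\alpha}\varphi$. Weak fractional derivatives ($0<\alpha<1$): $v\in L^1_{loc}(\mathbb{R})$ is the left (resp. right) weak fractional derivative of $u$, written ${}^{-}\mathcal{D}^{\alpha}u=v$ (resp. ${}^{+}\mathcal{D}^{\alpha}u=v$), if $\int_{\mathbb{R}} v\varphi\,dx=\int_{\mathbb{R}} u\,{}^{+}D^{\alpha}\varphi\,dx$ (resp. with ${}^{-}D^{\alpha}\varphi$ on the right-hand side) for all $\varphi\in C_0^\infty(\mathbb{R})$. ${}^{\pm}W^{\alpha,p}(\mathbb{R})=\{u\in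 L^p(\mathbb{R}):{}^{\pm}\mathcal{D}^{\alpha}u\in L^p(\mathbb{R})\}$. *)

(* Defs.v *)
From HB Require Import structures.
From mathcomp Require Import all_boot all_order all_algebra.
From mathcomp Require Import all_classical all_reals all_analysis.
Set Implicit Arguments.
Unset Strict Implicit.
Unset Printing Implicit Defensive.
Import Order.TTheory GRing.Theory Num.Theory.
Import numFieldNormedType.Exports.
Local Open Scope classical_set_scope.
Local Open Scope ring_scope.

Definition Gamma {R : realType} (s : R) : R :=
  \int[lebesgue_measure]_(t in `]0, +oo[) (t `^ (s - 1) * expR (- t)).

(* [minus] is the sign of the left operators, [plus] that of the right ones. *)
Variant sign := minus | plus.

Definition flip (s : sign) : sign :=
  match s with minus => plus | plus => minus end.

(* [Rintegral] is 0 when the integral diverges; on test functions, the only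
   ones to which [fracI] is applied below, the integral converges. *)
Definition fracI {R : realType} (s : sign) (sigma : R) (f : R -> R) (x : R)
    : R :=
  (Gamma sigma)^-1 *
  match s with
  | minus =>
      \int[lebesgue_measure]_(y in `]-oo, x[) (f y / (x - y) `^ (1 - sigma))
  | plus =>
      \int[lebesgue_measure]_(y in `]x, +oo[) (f y / (y - x) `^ (1 - sigma))
  end.

Definition fracD {R : realType} (s : sign) (alpha : R) (phi : R -> R) (x : R)
    : R :=
  match s with
  | minus => derive1 (fracI minus (1 - alpha) phi) x
  | plus => - derive1 (fracI plus (1 - alpha) phi) x
  end.

Definition test_function {R : realType} (phi : R -> R) : Prop :=
  (forall (n : nat) (x : R), derivable (derive1n n phi) x 1) /\
  compact (closure [set x : R | phi x != 0]).

(* The two sides are extended-real integrals. The left one is finite since v is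
   locally integrable, and +oo - +oo = -oo, so the equation forces
   u * fracD (flip s) alpha phi to be integrable when it is measurable. *)
Definition weak_fracD {R : realType} (s : sign) (alpha : R) (u v : R -> R)
    : Prop :=
  locally_integrable [set: R] v /\
  forall phi : R -> R, test_function phi ->
    (\int[lebesgue_measure]_x (v x * phi x)%:E =
     \int[lebesgue_measure]_x (u x * fracD (flip s) alpha phi x)%:E)%E.

Definition fracW {R : realType} (s : sign) (alpha p : R) : set (R -> R) :=
  [set u | u \in Lfun lebesgue_measure p%:E /\
     exists v : R -> R,
       weak_fracD s alpha u v /\ v \in Lfun lebesgue_measure p%:E].

(* Main.v *)
Require Import Defs.
From HB Require Import structures.
From mathcomp Require Import all_boot all_order all_algebra.
From mathcomp Require Import all_classical all_reals all_analysis.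
From mathcomp Require Import measurable_realfun ring lra.
Set Implicit Arguments.
Unset Strict Implicit.
Unset Printing Implicit Defensive.
Import Order.TTheory GRing.Theory Num.Theory.
Import numFieldNormedType.Exports.
Local Open Scope classical_set_scope.
Local Open Scope ring_scope.

(** Write [J f x] for the integral of [t^(alpha-1) |f (x - t)|] over [t > 0].
    By Fubini and the beta integral, a test function [phi] is, up to a constant,
    the superposition with weights [r^(alpha-1)] of the translates
    [fracD phi (. + r)], [r > 0].  Inserting the translates [phi (. + r)] in the
    definition of the weak derivative and integrating against [r^(alpha-1)]
    gives [|int u phi| <= c int |phi| J v]; integrability of [u] is what makes
    the exchange of integrals legitimate.  Letting [phi] increase to the
    indicator of an interval, Lebesgue differentiation yields [|u| <= c J v]
    almost everywhere.  It remains to bound [J] from L^p to L^p*: Hedberg's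
    pointwise inequality
    [J f <= C |f|_p^(alpha p) (M f)^(1 - alpha p)], with [M] the
    Hardy-Littlewood maximal function, reduces this to the strong (p, p)
    maximal inequality.  The right-sided case follows by reflection. *)

(** * Affine changes of variables *)

(** No representation of [u] as a fractional integral of [v] is established: only an upper bound
    survives, and on the side of [v] all comparisons are between nonnegative integrals. Hence
    [riesz a v] may be [+oo] until the Hardy-Littlewood-Sobolev bound makes it finite almost
    everywhere.

    The superposition formula comes from letting the derivative fall on the test function: the right
    derivative of [phi] is [- 1 / Gamma (1 - a)] times the Weyl integral of order [1 - a] of [phi'].
    A second integration against [r^(a-1)] convolves [t_+^(a-1)] with [t_+^(-a)]. These powers are
    homogeneous of total degree -1, so the convolution is a constant [b] on the half-line, and what
    remains is the integral of [phi'] over []x, +oo[], that is [- phi x]. The constant of the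
    duality estimate is therefore [Gamma (1 - a) / b].

    For the exchange of integrals, the weighted integral of the absolute value of the derivative at
    [x + r] is bounded uniformly in [x] by a multiple of the L^1 norm of [phi']. A bound of this
    kind pairs with an integrable [u]. *)

Section affine.
Context {R : realType}.
Local Notation mu := (@lebesgue_measure R).
Implicit Types f : R -> \bar R.

Let affine (a b : R) : measurableTypeR R -> measurableTypeR R :=
  fun x => a * x + b.

Lemma measurable_affine (a b : R) : measurable_fun setT (affine a b).
Proof.
by apply: measurable_funD => //; apply: measurable_funM => //.
Qed.

(** Lebesgue measure is determined by its values on the intervals []x, y]], so it is enough to
    compute the preimage of one such interval. *)
Lemma lebesgue_measure_affine (a b : R) (a0 : 0 < a) (A : set R) :
  measurable A ->
  mu A = (a%:E * pushforward mu (affine a b) A)%E.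
Proof.
move=> mA; rewrite -[RHS]/(mscale (NngNum (ltW a0))
  (measure_function_pushforward__canonical__measure_function_Measure mu
    (measurable_affine a b)) A).
apply: lebesgue_measure_unique => // _ [[x y]] _ <-.
have E : affine a b @^-1` `]x, y]%classic = `](x - b) / a, (y - b) / a]%classic.
  apply/seteqP; split => z /=; rewrite /affine !in_itv/=.
    by rewrite ltr_pdivrMr// ler_pdivlMr// ltrBlDr lerBrDr mulrC.
  by rewrite ltr_pdivrMr// ler_pdivlMr// ltrBlDr lerBrDr mulrC.
rewrite -[RHS]/(a%:E * mu (affine a b @^-1` `]x, y]%classic))%E E.
rewrite !lebesgue_measure_itv/= !lte_fin ltr_pM2r ?invr_gt0// ltrD2r.
case: ifPn => // xy; last by rewrite mule0.
rewrite -!EFinB -EFinM; congr EFin; field; exact: lt0r_neq0.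
Qed.

Lemma ge0_integral_affine (a b : R) f : 0 < a -> measurable_fun setT f ->
  (forall x, 0 <= f x)%E ->
  (a%:E * \int[mu]_x f (a * x + b)%R = \int[mu]_x f x)%E.
Proof.
move=> a0 mf f0.
rewrite [RHS](eq_measure_integral
  (mscale (NngNum (ltW a0))
    (measure_function_pushforward__canonical__measure_function_Measure mu
      (measurable_affine a b)))); last first.
  by move=> A mA _; exact: lebesgue_measure_affine.
rewrite ge0_integral_mscale//=; congr (_ * _)%E.
by rewrite ge0_integral_pushforward// ?preimage_setT//=; try exact: measurable_affine.
Qed.

Lemma ge0_integral_shift (b : R) f : measurable_fun setT f ->
  (forall x, 0 <= f x)%E -> (\int[mu]_x f (x + b)%R = \int[mu]_x f x)%E.
Proof.
move=> mf f0; rewrite -(ge0_integral_affine b ltr01 mf f0) mul1e.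
by under [RHS]eq_integral do rewrite mul1r.
Qed.

Lemma ge0_integralN f : measurable_fun setT f ->
  (forall x, 0 <= f x)%E -> (\int[mu]_x f (- x)%R = \int[mu]_x f x)%E.
Proof.
move=> mf f0.
rewrite [RHS](eq_measure_integral
  (pushforward mu (-%R : measurableTypeR R -> measurableTypeR R))); last first.
  by move=> A mA _; exact/esym/lebesgue_measureN.
by rewrite ge0_integral_pushforward// ?preimage_setT//=; move=> y _; exact: f0.
Qed.

Lemma ge0_integral_rev (b : R) f : measurable_fun setT f ->
  (forall x, 0 <= f x)%E -> (\int[mu]_x f (b - x)%R = \int[mu]_x f x)%E.
Proof.
move=> mf f0; rewrite -(ge0_integral_shift b mf f0) -ge0_integralN//=.
- by apply: eq_integral => x _; rewrite opprK addrC.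
- apply: (measurableT_comp mf); exact: measurable_funB.
Qed.

(** The integral is by definition that of [f^\+] minus that of [f^\-], so the nonnegative case
    applied to each part also covers functions that are not integrable. *)
Lemma integral_shift (b : R) f : measurable_fun setT f ->
  (\int[mu]_x f (x + b)%R = \int[mu]_x f x)%E.
Proof.
move=> mf; rewrite integralE [RHS]integralE; congr (_ - _)%E.
- rewrite -[RHS](@ge0_integral_shift b f^\+%E)//; last exact: measurable_funepos.
  by apply: eq_integral => x _; rewrite !funeposE.
- rewrite -[RHS](@ge0_integral_shift b f^\-%E)//; last exact: measurable_funeneg.
  by apply: eq_integral => x _; rewrite !funenegE.
Qed.

Lemma integral_oppr f : measurable_fun setT f ->
  (\int[mu]_x f (- x)%R = \int[mu]_x f x)%E.
Proof.
move=> mf; rewrite integralE [RHS]integralE; congr (_ - _)%E.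
- rewrite -[RHS](@ge0_integralN f^\+%E)//; last exact: measurable_funepos.
  by apply: eq_integral => x _; rewrite !funeposE.
- rewrite -[RHS](@ge0_integralN f^\-%E)//; last exact: measurable_funeneg.
  by apply: eq_integral => x _; rewrite !funenegE.
Qed.

End affine.

(** * Integrals of powers *)

Section powint.
Context {R : realType}.
Local Notation mu := (@lebesgue_measure R).

Lemma derivable_powR_div (s x : R) : s != 0 -> 0 < x ->
  derivable (fun t => t `^ s / s) x 1 /\
  derive1 (fun t => t `^ s / s) x = x `^ (s - 1).
Proof.
move=> s0 x0.
have d : is_derive x 1 (fun t : R => t `^ s / s) (x `^ (s - 1)).
  rewrite (_ : (fun _ => _) = s^-1 \*: (@powR R ^~ s)); last first.
    by apply/funext => t /=; rewrite mulrC.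
  apply: is_derive_eq; first exact: is_deriveZ (is_derive1_powR s x0).
  by rewrite /GRing.scale/= mulrA mulVf// mul1r.
by split; [exact: ex_derive | rewrite derive1E; case: d].
Qed.

Lemma continuous_powR_gt0 (s x : R) : 0 < x -> {for x, continuous (@powR R ^~ s)}.
Proof.
move=> x0; apply: differentiable_continuous; apply/derivable1_diffP.
by apply: derivable_powR; rewrite in_itv/= x0.
Qed.

Lemma powR_cvgNy (s : R) : 0 < s -> t `^ (- s) @[t --> +oo] --> (0 : R).
Proof.
move=> s0; under eq_fun do rewrite powRN.
apply/gtr0_cvgV0.
  by near=> t; rewrite powR_gt0//; near: t; exact: nbhs_pinfty_gt.
apply/cvgryPge => A; near=> t.
have At : `|A| `^ s^-1 <= t by near: t; exact: nbhs_pinfty_ge.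
rewrite (le_trans (ler_norm A))//.
rewrite -[leLHS](@powRr1 _ `|A|)// -(mulVf (lt0r_neq0 s0)) powRrM.
by apply: ge0_ler_powR; rewrite ?nnegrE ?powR_ge0 ?(ltW s0)// (le_trans _ At)// powR_ge0.
Unshelve. all: by end_near. Qed.

Lemma continuous_powR_div (s x : R) : s != 0 -> 0 < x ->
  {for x, continuous (fun t => t `^ s / s)}.
Proof.
move=> s0 x0; apply: differentiable_continuous; apply/derivable1_diffP.
by have [] := derivable_powR_div s0 x0.
Qed.

Lemma integral_powR_itvcc (s a b : R) : s != 0 -> 0 < a -> a < b ->
  (\int[mu]_(t in `[a, b]) (t `^ (s - 1))%:E = (b `^ s / s - a `^ s / s)%:E)%E.
Proof.
move=> s0 a0 ab.
rewrite (@continuous_FTC2 _ _ (fun t => t `^ s / s))//.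
- apply: continuous_in_subspaceT => x; rewrite inE/= in_itv/= => /andP[ax _].
  exact: continuous_powR_gt0 (lt_le_trans a0 ax).
- split.
  + move=> x; rewrite in_itv/= => /andP[ax _].
    by have [] := derivable_powR_div s0 (lt_trans a0 ax).
  + exact/cvg_at_right_filter/continuous_powR_div.
  + exact/cvg_at_left_filter/continuous_powR_div/(lt_trans a0 ab).
- move=> x; rewrite in_itv/= => /andP[ax _].
  by have [] := derivable_powR_div s0 (lt_trans a0 ax).
Qed.

Lemma integral_powR_itvoc (s b : R) : 0 < s -> 0 < b ->
  (\int[mu]_(t in `]0%R, b]) (t `^ (s - 1))%:E = (b `^ s / s)%:E)%E.
Proof.
move=> s0 b0.
(* The primitive is evaluated away from the singularity at 0, and monotone convergence lets the left
   end tend to 0. The denominator starts at 2 so that [a i < b] already for [i = 0]. *)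
pose a (i : nat) := b / i.+2%:R.
have a0 i : 0 < a i by rewrite divr_gt0.
have ab i : a i < b by rewrite ltr_pdivrMr// ltr_pMr// ltr1n.
have -> : `]0, b]%classic = \bigcup_i `[a i, b]%classic.
  apply/seteqP; split => [x|x [i _]]/=; rewrite !in_itv/=; last first.
    by move=> /andP[ax ->]; rewrite (lt_le_trans (a0 i) ax).
  move=> /andP[x0 xb]; exists (Num.trunc (b / x)) => //=.
  rewrite in_itv/= xb andbT ler_pdivrMr// mulrC -ler_pdivrMr//.
  rewrite (le_trans (ltW (truncnS_gt _)))// ler_nat.
  by rewrite leqnSn.
have nd : nondecreasing_seq (fun i => `[a i, b]%classic).
  apply/nondecreasing_seqP => i; apply/subsetPset => x/=; rewrite !in_itv/=.
  move=> /andP[ax ->]; rewrite andbT (le_trans _ ax)//.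
  by rewrite ler_pM2l// lef_pV2 ?posrE// ler_nat.
have H : (\int[mu]_(t in `[a i, b]) (t `^ (s - 1))%:E @[i --> \oo] -->
    \int[mu]_(t in \bigcup_i `[a i, b]%classic) (t `^ (s - 1))%:E)%E.
  apply: (@ge0_nondecreasing_set_cvg_integral _ (measurableTypeR R)) => //.
  - move=> i; apply: measurable_funTS; apply/measurable_EFinP.
    exact: measurable_powR.
  - by move=> i t _; rewrite lee_fin powR_ge0.
rewrite -(cvg_lim _ H)//.
apply/cvg_lim => //.
under eq_fun do rewrite integral_powR_itvcc ?gt_eqF//.
apply: cvg_EFin; first exact: nearW.
rewrite -[X in _ --> X]subr0; apply: cvgB; first exact: cvg_cst.
rewrite -[X in _ --> X](mul0r s^-1); apply: cvgMl.
have := @powR_cvg0 R s s0 => /cvg_at_rightP; apply; split => //.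
rewrite /a -(mulr0 b); apply: cvgMr.
have := @cvg_harmonic R; rewrite -(cvg_shiftS) /=; exact.
Qed.

Lemma integral_powR_tail (s b : R) : 0 < s -> 0 < b ->
  (\int[mu]_(t in `[b, +oo[) (t `^ (- s - 1))%:E = (b `^ (- s) / s)%:E)%E.
Proof.
move=> s0 b0.
rewrite (@ge0_continuous_FTC2y _ _ (fun t => t `^ (- s) / (- s)) _ 0).
- by rewrite -EFinB sub0r invrN mulrN opprK.
- by move=> x _; rewrite powR_ge0.
- apply: continuous_in_subspaceT => x; rewrite inE/= in_itv/= andbT => bx.
  exact: continuous_powR_gt0 (lt_le_trans b0 bx).
- rewrite -(mul0r (- s)^-1); apply: cvgMl.
  exact: powR_cvgNy.
- move=> x bx; have [] // := @derivable_powR_div (- s) x _ (lt_trans b0 bx).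
  by rewrite oppr_eq0 gt_eqF.
- apply: cvg_at_right_filter; apply: continuous_powR_div => //.
  by rewrite oppr_eq0 gt_eqF.
- move=> x; rewrite in_itv/= andbT => bx.
  have [] // := @derivable_powR_div (- s) x _ (lt_trans b0 bx).
  by rewrite oppr_eq0 gt_eqF.
Qed.

End powint.

(** * Maximal inequalities *)

Section kernel.
Context {R : realType}.
Local Notation mu := (@lebesgue_measure R).

(* [t_+^(s-1)]; the test is needed because [powR] takes the junk value 1 at
   negative reals. *)
Definition pker (s t : R) : R := if 0 < t then t `^ (s - 1) else 0.

Lemma pker_ge0 (s t : R) : 0 <= pker s t.
Proof. by rewrite /pker; case: ifP => // _; exact: powR_ge0. Qed.

Lemma measurable_bool_natr d (T : measurableType d) (b : T -> bool) :
  measurable_fun setT b -> measurable_fun setT (fun x => (b x)%:R : R).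
Proof.
move=> mb; rewrite (_ : (fun _ => _) = fun x => if b x then 1 else 0 : R).
  by apply: measurable_fun_ifT => //; exact: measurable_cst.
by apply/funext => x; case: (b x).
Qed.

Lemma measurable_pker (s : R) : measurable_fun setT (pker s).
Proof.
apply: measurable_fun_ifT; [|exact: measurable_powR|exact: measurable_cst].
by apply: measurable_fun_ltr => //; exact: measurable_cst.
Qed.

Lemma measurable_pker_comp d (T : measurableType d) (s : R) (g : T -> R) :
  measurable_fun setT g -> measurable_fun setT (fun x => pker s (g x)).
Proof. by move=> mg; apply: (measurableT_comp (measurable_pker s)). Qed.

Lemma integral_pker_lt (s b : R) : 0 < s -> 0 <= b ->
  (\int[mu]_t (pker s t * (t < b)%R%:R)%:E = (b `^ s / s)%:E)%E.
Proof.
move=> s0; rewrite le_eqVlt => /predU1P[<-|b0].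
  rewrite powR0 ?gt_eqF// mul0r integral0_eq// => t _.
  by rewrite /pker; have [t0|t0] := ltP 0 t; rewrite ?mul0r// ltNge ltW// mulr0.
rewrite -integral_powR_itvoc// -integral_itv_bndo_bndc; last first.
  by apply: measurable_funTS; apply/measurable_EFinP; exact: measurable_powR.
rewrite [RHS]integral_mkcond; apply: eq_integral => t _.
rewrite patchE mem_setE in_itv/= /pker.
by have [t0|t0] := ltP 0 t; have [tb|tb] := ltP t b; rewrite ?mulr1 ?mulr0.
Qed.

Lemma integral_pker_gt (s b : R) : 0 < s -> 0 < b ->
  (\int[mu]_t (pker (- s) t * (b < t)%R%:R)%:E = (b `^ (- s) / s)%:E)%E.
Proof.
move=> s0 b0; rewrite -integral_powR_tail// -integral_itv_obnd_cbnd; last first.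
  by apply: measurable_funTS; apply/measurable_EFinP; exact: measurable_powR.
rewrite [RHS]integral_mkcond; apply: eq_integral => t _.
rewrite patchE mem_setE in_itv/= /pker andbT.
have [bt|bt] := ltP b t; last by rewrite mulr0.
by rewrite (lt_trans b0 bt) mulr1.
Qed.

Lemma integral_pker_lty (s : R) : 0 < s -> (\int[mu]_t (pker s t)%:E = +oo)%E.
Proof.
move=> s0; apply/eqyP => A A0.
have As0 : 0 <= A * s by rewrite mulr_ge0// ltW.
(* The cut-off is chosen so that the truncated integral is exactly [A]. *)
apply: (@le_trans _ _ (\int[mu]_t (pker s t * (t < (A * s) `^ s^-1)%R%:R)%:E)%E).
  rewrite integral_pker_lt ?powR_ge0// lee_fin -powRrM mulVf ?gt_eqF// powRr1//.
  by rewrite mulfK// gt_eqF.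
apply: ge0_le_integral => //.
- by move=> x _; rewrite lee_fin mulr_ge0// pker_ge0.
- apply/measurable_EFinP; apply: measurable_funM; first exact: measurable_pker.
  by apply: measurable_bool_natr; apply: measurable_fun_ltr => //; exact: measurable_cst.
- by apply/measurable_EFinP; exact: measurable_pker.
- by move=> x _; rewrite lee_fin ler_piMr// ?pker_ge0// lern1 leq_b1.
Qed.

(** The height [y] is an extended real because a maximal function, to which this is applied, may be
    infinite. *)
Lemma layer_cake (p : R) (y : \bar R) : 0 < p -> (0 <= y)%E ->
  (y `^ p = p%:E * \int[mu]_t (pker p t * (t%:E < y)%E%:R)%:E)%E.
Proof.
move=> p0; case: y => [r||//] y0.
  by rewrite integral_pker_lt// poweR_EFin -EFinM mulrCA mulfV ?mulr1// gt_eqF.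
rewrite poweRyr ?gt_eqF//.
under eq_integral do rewrite ltry mulr1.
by rewrite integral_pker_lty// gt0_muley.
Qed.

End kernel.

Section maximal.
Context {R : realType}.
Local Notation mu := (@lebesgue_measure R).
Implicit Types f : R -> R.

Lemma locally_integrable_le f g : measurable_fun setT f ->
  (forall x, `|f x| <= `|g x|) -> locally_integrable setT g ->
  locally_integrable setT f.
Proof.
move=> mf fg [mg oT ig]; split => // K KT cK.
apply: le_lt_trans (ig K KT cK); apply: ge0_le_integral => //=.
- exact: compact_measurable.
- by apply: measurable_funTS; do 2 apply: measurableT_comp => //.
- by apply: measurable_funTS; do 2 apply: measurableT_comp => //.
- by move=> x _; rewrite lee_fin.
Qed.

(** Averages of the part of [f] below [t / 2] never exceed [t / 2], so where the maximal function of
    [f] exceeds [t], that of the remaining part exceeds [t / 2]. The weak (1, 1) inequality, with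
    constant 3, at height [t / 2] gives the 6. *)
Lemma maximal_inequality_truncated f (t : R) : locally_integrable setT f ->
  0 < t ->
  (mu [set x | t%:E < HL_maximal f x] <=
   (6 / t)%:E * \int[mu]_x (`|f x| * (t < 2 * `|f x|)%R%:R)%:E)%E.
Proof.
move=> lf t0; have [mf _ _] := lf.
have mb : measurable_fun setT (fun x => (t < 2 * `|f x|)).
  apply: measurable_fun_ltr; first exact: measurable_cst.
  by apply: measurable_funM; [exact: measurable_cst|exact: measurableT_comp].
(* [f] splits into [g] and [h], and [|h| <= t / 2]. *)
pose g x := f x * (t < 2 * `|f x|)%R%:R.
pose h x := f x * (~~ (t < 2 * `|f x|)%R)%:R.
have mg : measurable_fun setT g.
  by apply: measurable_funM => //; exact: measurable_bool_natr.
have mh : measurable_fun setT h.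
  apply: measurable_funM => //; apply: measurable_bool_natr.
  exact: measurable_neg.
have fgh : f = (g \+ h)%R.
  by apply/funext => x; rewrite /g /h /=; case: (t < _);
    rewrite ?mulr1 ?mulr0 ?addr0 ?add0r.
have lg : locally_integrable setT g.
  apply: locally_integrable_le lf => // x.
  by rewrite /g; case: (t < _); rewrite ?mulr1// mulr0 normr0.
have sub : [set x | t%:E < HL_maximal f x]%E `<=`
    [set x | (t / 2)%:E < HL_maximal g x]%E.
  move=> x /= /ereal_sup_gt[z /= [r + <-{z}] tf]; rewrite in_itv/= andbT => r0.
  have hB : (iavg h (ball x r) <= (t / 2)%:E)%E.
    rewrite /iavg lebesgue_measure_ball ?(ltW r0)// inver mulrn_eq0/= gt_eqF//.
    rewrite lee_pdivrMl ?mulrn_wgt0// -EFinM.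
    apply: (@le_trans _ _ (\int[mu]_(y in ball x r) (t / 2)%:E)%E).
      apply: ge0_le_integral => //=.
      - exact: measurable_ball.
      - by apply: measurable_funTS; do 2 apply: measurableT_comp => //.
      - move=> y _; rewrite lee_fin /h; case: ltP => /= hy.
          by rewrite mulr0 normr0 divr_ge0// ltW.
        by rewrite mulr1 ler_pdivlMr// mulrC.
    rewrite integral_cst; last exact: measurable_ball.
    by rewrite /= lebesgue_measure_ball ?(ltW r0)// -EFinM mulrC.
  have gB : (iavg g (ball x r) <= HL_maximal g x)%E.
    by apply: ereal_sup_ubound; exists r => //=; rewrite in_itv/= r0.
  apply: lt_le_trans gB.
  have := iavgD (measurable_ball x r) _ (measurable_funTS mg) (measurable_funTS mh).
  rewrite lebesgue_measure_ball ?(ltW r0)// ltry -fgh => /(_ erefl) fB.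
  have tgh : (t%:E < iavg g (ball x r) + (t / 2)%:E)%E.
    by apply: (lt_le_trans tf); apply: (le_trans fB); exact: leeD2l.
  move: tgh; rewrite -lteBlDr// -EFinB; congr (_ < _)%E; congr EFin.
  by field.
apply: (le_trans (le_measure mu _ _ sub)).
- rewrite inE -[X in measurable X]setTI; apply: emeasurable_fun_o_infty => //.
  exact: measurable_HL_maximal.
- rewrite inE -[X in measurable X]setTI; apply: emeasurable_fun_o_infty => //.
  exact: measurable_HL_maximal.
apply: (le_trans (maximal_inequality lg _)); first by rewrite divr_gt0.
rewrite invf_div mulrA -natrM; apply: lee_wpmul2l.
  by rewrite lee_fin divr_ge0// ltW.
apply: ge0_le_integral => //=.
- by do 2 apply: measurableT_comp => //.
- apply/measurable_EFinP; apply: measurable_funM; first exact: measurableT_comp.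
  exact: measurable_bool_natr.
- by move=> x _; rewrite lee_fin /g normrM; case: (t < _); rewrite ?normr1 ?normr0.
Qed.

End maximal.

(** * The strong (p, p) maximal inequality *)

Section strong_maximal.
Context {R : realType}.
Local Notation mu := (@lebesgue_measure R).
Implicit Types f : R -> R.

Lemma pker_div (s t : R) : pker s t / t = pker (s - 1) t.
Proof.
rewrite /pker; case: ltP => t0; last by rewrite mul0r.
rewrite (@powRB _ t (s - 1) 1) ?powRr1 ?(ltW t0)//.
by rewrite (gt_eqF t0) implybT.
Qed.

Lemma integral_bool (b : R -> bool) : measurable_fun setT b ->
  (\int[mu]_x ((b x)%:R)%:E = mu [set x | b x])%E.
Proof.
move=> mb; have mB : measurable [set x | b x].
  by have := mb measurableT [set true] I; rewrite setTI.
rewrite -[X in mu X]setIT -integral_indic//; apply: eq_integral => x _.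
rewrite indicE; congr (_%:R%:E); congr nat_of_bool.
by apply/idP/idP => [bx|]; rewrite inE.
Qed.

(* Layer cake: at height [t] the weak (1, 1) inequality is applied to the part of
   [f] above [t / 2], and Tonelli integrates in [t] first. *)
Lemma strong_maximal_inequality (p : R) f : 1 < p ->
  locally_integrable setT f ->
  (\int[mu]_x (HL_maximal f x `^ p) <=
   (6 * p * 2 `^ (p - 1) / (p - 1))%:E * \int[mu]_x (`|f x| `^ p)%:E)%E.
Proof.
move=> p1 lf; have [mf _ _] := lf.
have p0 : 0 < p by exact: lt_trans p1.
have mM := measurable_HL_maximal lf.
pose K (z : measurableTypeR R * measurableTypeR R) :=
  (pker p z.2 * (z.2%:E < HL_maximal f z.1)%E%:R)%:E.
have mK : measurable_fun setT K.
  apply/measurable_EFinP; apply: measurable_funM.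
    exact: measurable_pker_comp.
  apply: measurable_bool_natr; apply: measurable_fun_lte.
    by apply/measurable_EFinP.
  exact: measurableT_comp.
have K0 z : (0 <= K z)%E by rewrite lee_fin mulr_ge0// pker_ge0.
pose L (z : measurableTypeR R * measurableTypeR R) :=
  (`|f z.1| * (pker (p - 1) z.2 * (z.2 < 2 * `|f z.1|)%R%:R))%:E.
have mf1 : measurable_fun setT
    (fun z : measurableTypeR R * measurableTypeR R => `|f z.1|).
  by apply: measurableT_comp => //; exact: measurableT_comp.
have mL : measurable_fun setT L.
  apply/measurable_EFinP; apply: measurable_funM => //.
  apply: measurable_funM; first exact: measurable_pker_comp.
  apply: measurable_bool_natr; apply: measurable_fun_ltr => //.
  by apply: measurable_funM => //; exact: measurable_cst.
have L0 z : (0 <= L z)%E by rewrite lee_fin !mulr_ge0// pker_ge0.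
have -> : (\int[mu]_x (HL_maximal f x `^ p) =
    p%:E * \int[mu]_t \int[mu]_x K (x, t))%E.
  rewrite -(fubini_tonelli K)// -ge0_integralZl//.
  - by apply: eq_integral => x _; rewrite layer_cake// HL_maximalT_ge0.
  - exact: (measurable_fun_fubini_tonelli_F K).
  - by move=> x _; exact: integral_ge0.
  - by rewrite lee_fin ltW.
have E1 : (\int[mu]_t \int[mu]_x K (x, t) <=
    \int[mu]_t (6%:E * \int[mu]_x L (x, t)))%E.
  apply: ge0_le_integral => //.
  - by move=> t _; exact: integral_ge0.
  - exact: (measurable_fun_fubini_tonelli_G K).
  - by apply: measurable_funeM; exact: (measurable_fun_fubini_tonelli_G L).
  move=> t _; have [t0|t0] := ltP 0 t; last first.
    rewrite integral0_eq ?mule_ge0 ?integral_ge0// => x _.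
    by rewrite /K /pker/= ltNge t0 mul0r.
  have mb : measurable_fun setT (fun x : R => (t%:E < HL_maximal f x)%E).
    by apply: measurable_fun_lte => //; exact: measurable_cst.
  have -> : (\int[mu]_x K (x, t) =
      (pker p t)%:E * mu [set x | t%:E < HL_maximal f x])%E.
    rewrite -integral_bool// -ge0_integralZl//.
    - by apply/measurable_EFinP; exact: measurable_bool_natr.
    - by rewrite lee_fin pker_ge0.
  apply: (le_trans (lee_wpmul2l _ (maximal_inequality_truncated lf t0))).
    by rewrite lee_fin pker_ge0.
  (* The factor [1 / t] of the weak inequality lowers the exponent of the kernel from [p - 1] to
     [p - 2]. *)
  rewrite muleA -EFinM mulrCA pker_div EFinM -muleA lee_wpmul2l//.
  have mg : measurable_fun setT (fun x : R => `|f x| * (t < 2 * `|f x|)%R%:R).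
    apply: measurable_funM; first exact: measurableT_comp.
    apply: measurable_bool_natr; apply: measurable_fun_ltr.
      exact: measurable_cst.
    by apply: measurable_funM; [exact: measurable_cst|exact: measurableT_comp].
  rewrite -ge0_integralZl//; last 2 first.
  - exact/measurable_EFinP.
  - by rewrite lee_fin pker_ge0.
  - by under eq_integral do rewrite -EFinM mulrCA.
apply: (le_trans (lee_wpmul2l _ E1)); first by rewrite lee_fin ltW.
rewrite ge0_integralZl//; last 2 first.
- exact: (measurable_fun_fubini_tonelli_G L).
- by move=> t _; exact: integral_ge0.
rewrite -(fubini_tonelli L)//.
(* For fixed [x] the height runs over [0 < t < 2 |f x|]. The integral of [t^(p-2)] converges at 0
   because [p > 1], and it produces both [2^(p-1)] and the denominator [p - 1]. *)
have E2 x : (\int[mu]_t L (x, t) =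
    (2 `^ (p - 1) / (p - 1))%:E * (`|f x| `^ p)%:E)%E.
  rewrite /L/=; under eq_integral do rewrite EFinM.
  rewrite ge0_integralZl//; last 2 first.
  - apply/measurable_EFinP; apply: measurable_funM; first exact: measurable_pker.
    by apply: measurable_bool_natr; apply: measurable_fun_ltr => //;
      exact: measurable_cst.
  - by move=> t _; rewrite lee_fin mulr_ge0// pker_ge0.
  rewrite integral_pker_lt ?subr_gt0 ?mulr_ge0// -!EFinM; congr EFin.
  rewrite powRM// -(@mulr_powRB1 _ `|f x| p)//.
  by rewrite -[RHS]mulrAC !mulrA; ring.
under eq_integral do rewrite E2.
rewrite ge0_integralZl//; last 2 first.
- apply/measurable_EFinP; apply: (measurableT_comp (measurable_powR p)).
  exact: measurableT_comp.
- by rewrite lee_fin divr_ge0 ?powR_ge0// subr_ge0 ltW.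
by rewrite !muleA -!EFinM (mulrC p) !mulrA.
Qed.

End strong_maximal.

(** * Riesz potentials and the Hardy-Littlewood-Sobolev inequality *)

Section slabs.
Context {R : realType}.
Local Notation mu := (@lebesgue_measure R).
Local Notation RR := (measurableTypeR R).
Implicit Types f : R -> R.

(* Unnormalised and extended-real valued, so that no integrability is needed
   before Hedberg's inequality is available. *)
Definition riesz (s : R) f (x : R) : \bar R :=
  (\int[mu]_t (pker s t * `|f (x - t)|)%:E)%E.

(** One-sided, since [riesz] only sees the values of [f] to the left of [x]. *)
Definition slab f (x r : R) : \bar R :=
  (\int[mu]_y (`|f y| * (x - r < y < x)%R%:R)%:E)%E.

Lemma riesz_ge0 s f x : (0 <= riesz s f x)%E.
Proof. by apply: integral_ge0 => t _; rewrite lee_fin mulr_ge0// pker_ge0. Qed.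

Lemma slab_ge0 f x r : (0 <= slab f x r)%E.
Proof. by apply: integral_ge0 => t _; rewrite lee_fin mulr_ge0. Qed.

Lemma measurable_slab_fun f (x r : R) : measurable_fun setT f ->
  measurable_fun setT (fun y : R => `|f y| * (x - r < y < x)%R%:R).
Proof.
move=> mf; apply: measurable_funM; first exact: measurableT_comp.
apply: measurable_bool_natr; apply: measurable_and.
- by apply: measurable_fun_ltr => //; exact: measurable_cst.
- by apply: measurable_fun_ltr => //; exact: measurable_cst.
Qed.

(** The slab lies in [ball x r], whose measure is the factor [2 * r]. *)
Lemma slab_le_maximal f x r : locally_integrable setT f -> 0 < r ->
  (slab f x r <= (2 * r)%:E * HL_maximal f x)%E.
Proof.
move=> lf r0; have [mf _ _] := lf.
have gB : (iavg f (ball x r) <= HL_maximal f x)%E.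
  by apply: ereal_sup_ubound; exists r => //=; rewrite in_itv/= r0.
apply: (@le_trans _ _ ((2 * r)%:E * iavg f (ball x r))%E); last first.
  by apply: lee_wpmul2l => //; rewrite lee_fin mulr_ge0// ltW.
rewrite /iavg lebesgue_measure_ball ?(ltW r0)// inver mulrn_eq0/= gt_eqF//.
rewrite muleA -EFinM -[r *+ 2]mulr_natl mulfV ?mulf_neq0 ?gt_eqF// mul1e.
rewrite [leRHS]integral_mkcond; apply: ge0_le_integral => //.
- by apply/measurable_EFinP; exact: measurable_slab_fun.
- apply/(measurable_restrictT _ _).1; first exact: measurable_ball.
  by apply: measurable_funTS; do 2 apply: measurableT_comp => //.
- move=> y _; rewrite patchE; case: ifPn => /= yB.
    by rewrite lee_fin ler_piMr// lern1 leq_b1.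
  rewrite (_ : (x - r < y < x) = false) ?mulr0//.
  apply: contraNF yB => /andP[xry yx]; rewrite inE /ball/=.
  by rewrite ger0_norm ?subr_ge0 ?(ltW yx)// ltrBlDr -ltrBlDl.
Qed.

(** Hoelder's inequality against the indicator of an interval of length [r], whose norm for the
    conjugate exponent is [r^(1 - 1/p)]. *)
Lemma slab_le_Lnorm (p n : R) f x r : 1 < p -> measurable_fun setT f ->
  ('N[mu]_p%:E[EFin \o f] = n%:E)%E -> 0 < r ->
  (slab f x r <= (r `^ (1 - p^-1) * n)%:E)%E.
Proof.
move=> p1 mf fn r0.
have p0 : 0 < p by exact: lt_trans p1.
have q0 : 0 < 1 - p^-1 by rewrite subr_gt0 invf_lt1.
pose g y : R := (x - r < y < x)%R%:R.
have mb : measurable_fun setT (fun y => x - r < y < x).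
  apply: measurable_and.
  - by apply: measurable_fun_ltr => //; exact: measurable_cst.
  - by apply: measurable_fun_ltr => //; exact: measurable_cst.
have mg : measurable_fun setT g by exact: measurable_bool_natr.
have := @hoelder _ _ _ mu f g p (1 - p^-1)^-1 mf mg p0.
rewrite invr_gt0 invrK [p^-1 + _]addrC subrK => /(_ q0 erefl).
rewrite fn Lnorm1 muleC.
have -> : (\int[mu]_y `|(EFin \o (f \* g)%R) y| = slab f x r)%E.
  by apply: eq_integral => y _; rewrite /= normrM (ger0_norm (ler0n _ _)).
move=> /le_trans; apply; rewrite EFinM; apply: lee_wpmul2r.
  by rewrite -fn Lnorm_ge0.
rewrite unlock invrK.
rewrite (_ : (\int[mu]_y _)%E = r%:E) ?poweR_EFin//.
transitivity (mu `]x - r, x[%classic); last first.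
  by rewrite lebesgue_measure_itv/= lte_fin ltrBlDr ltrDl r0 -EFinB opprB addrC subrK.
rewrite (_ : `]x - r, x[%classic = [set y | x - r < y < x]); last first.
  by apply/seteqP; split => y/=; rewrite in_itv.
rewrite -integral_bool//; apply: eq_integral => y _; rewrite /= /g.
by case: (_ && _); rewrite ?normr1 ?powR1// normr0 powR0// invr_neq0// gt_eqF.
Qed.

(* [t^(a-1)] is [(1 - a)] times the integral of [r^(a-2)] over [r > t]. *)
Lemma riesz_slab (a : R) f x : 0 < a -> a < 1 -> measurable_fun setT f ->
  riesz a f x = ((1 - a)%:E * \int[mu]_r ((pker (a - 1) r)%:E * slab f x r))%E.
Proof.
move=> a0 a1 mf; have b0 : 0 < 1 - a by rewrite subr_gt0.
pose K (z : RR * RR) :=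
  (pker (a - 1) z.2 * (`|f z.1| * (x - z.2 < z.1 < x)%R%:R))%:E.
have mK : measurable_fun setT K.
  apply/measurable_EFinP; apply: measurable_funM.
    exact: measurable_pker_comp.
  apply: measurable_funM.
    by apply: measurableT_comp => //; exact: measurableT_comp.
  apply: measurable_bool_natr; apply: measurable_and.
  - apply: measurable_fun_ltr => //; apply: measurable_funB => //.
  - apply: measurable_fun_ltr => //.
have K0 z : (0 <= K z)%E by rewrite lee_fin !mulr_ge0// pker_ge0.
transitivity ((1 - a)%:E * \int[mu]_r \int[mu]_y K (y, r))%E; last first.
  congr (_ * _)%E; apply: eq_integral => r _.
  rewrite /K/=; under eq_integral do rewrite EFinM.
  rewrite ge0_integralZl//.
  - by apply/measurable_EFinP; exact: measurable_slab_fun.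
  - by rewrite lee_fin pker_ge0.
rewrite -(fubini_tonelli K)// -ge0_integralZl//; last 3 first.
- exact: (measurable_fun_fubini_tonelli_F K).
- by move=> y _; exact: integral_ge0.
- by rewrite lee_fin ltW.
(* The substitution [y = x - t] turns the slab condition into [0 < t < r], so that the integral over
   [r] is the tail integral of a power. *)
rewrite /riesz -(@ge0_integral_rev _ x
  (fun y => (1 - a)%:E * \int[mu]_r K (y, r))%E); last 2 first.
- by apply: measurable_funeM; exact: (measurable_fun_fubini_tonelli_F K).
- by move=> y; rewrite mule_ge0 ?integral_ge0// lee_fin ltW.
apply: eq_integral => t _; rewrite /K/=.
have xt r : (x - r < x - t < x) = (t < r) && (0 < t).
  by rewrite ltrD2l ltrN2 ltrBlDr ltrDl.
have [t0|t0] := ltP 0 t; last first.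
  rewrite /pker ltNge t0 mul0r integral0_eq ?mule0// => r _.
  by rewrite xt (le_gtF t0) andbF/= !mulr0.
under eq_integral do rewrite xt t0 andbT mulrCA EFinM.
rewrite ge0_integralZl//; last 2 first.
- apply/measurable_EFinP; apply: measurable_funM; first exact: measurable_pker.
  by apply: measurable_bool_natr; apply: measurable_fun_ltr => //; exact: measurable_cst.
- by move=> r _; rewrite lee_fin mulr_ge0// pker_ge0.
have := @integral_pker_gt _ _ _ b0 t0; rewrite opprB => ->.
rewrite -!EFinM; congr EFin; rewrite /pker t0.
by field; rewrite gt_eqF.
Qed.

End slabs.

Section hedberg.
Context {R : realType}.
Local Notation mu := (@lebesgue_measure R).
Local Notation RR := (measurableTypeR R).
Implicit Types f : R -> R.

Lemma pker_mul (s t : R) : pker s t * t = pker (s + 1) t.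
Proof.
rewrite -[in LHS](addrK 1 s) -pker_div /pker.
case: ltP => t0; last by rewrite !mul0r.
by rewrite divfK// gt_eqF.
Qed.

Lemma pker_powR (s c t : R) : 0 < t -> pker s t * t `^ c = pker (s + c) t.
Proof.
move=> t0; rewrite /pker t0 -powRD ?(gt_eqF t0) ?implybT//.
by congr (_ `^ _); ring.
Qed.

Lemma measurable_pker_bool (s : R) (b : R -> bool) : measurable_fun setT b ->
  measurable_fun setT (fun t : R => pker s t * (b t)%:R).
Proof.
move=> mb; apply: measurable_funM; first exact: measurable_pker.
exact: measurable_bool_natr.
Qed.

Lemma measurable_slab f x : measurable_fun setT f ->
  measurable_fun setT (slab f x).
Proof.
move=> mf; apply: (@measurable_fun_fubini_tonelli_G _ _ RR RR R mu
  (fun z => (`|f z.1| * (x - z.2 < z.1 < x)%R%:R)%:E)); last first.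
  by move=> z; rewrite lee_fin mulr_ge0.
apply/measurable_EFinP; apply: measurable_funM.
  by apply: measurableT_comp => //; exact: measurableT_comp.
apply: measurable_bool_natr; apply: measurable_and.
- by apply: measurable_fun_ltr => //; exact: measurable_funB.
- exact: measurable_fun_ltr.
Qed.

Lemma measurable_riesz_fun s f : measurable_fun setT f ->
  measurable_fun setT (fun z : RR * RR => pker s z.2 * `|f (z.1 - z.2)|).
Proof.
move=> mf; apply: measurable_funM; first exact: measurable_pker_comp.
do 2 apply: measurableT_comp => //; exact: measurable_funB.
Qed.

Lemma measurable_riesz s f : measurable_fun setT f ->
  measurable_fun setT (riesz s f).
Proof.
move=> mf; apply: (@measurable_fun_fubini_tonelli_F _ _ RR RR R mu
  (fun z => (pker s z.2 * `|f (z.1 - z.2)|)%:E)).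
- by apply/measurable_EFinP; exact: measurable_riesz_fun.
- by move=> z; rewrite lee_fin mulr_ge0// pker_ge0.
Qed.

(* The slabs of width [r < d] are bounded by the maximal function, the others by
   Hoelder's inequality.  The second region is enlarged to [d / 2 < r] so that
   both are described by strict inequalities. *)
Lemma riesz_le_maximal_Lnorm (a p n d : R) f x : 0 < a -> a < 1 -> 1 < p -> a < p^-1 ->
  locally_integrable setT f -> ('N[mu]_p%:E[EFin \o f] = n%:E)%E -> 0 < d ->
  (riesz a f x <=
    ((1 - a) * 2 / a * d `^ a)%:E * HL_maximal f x +
    ((1 - a) * 2 `^ (p^-1 - a) / (p^-1 - a) * (d `^ (- (p^-1 - a)) * n))%:E)%E.
Proof.
move=> a0 a1 p1 ap lf fn d0; have [mf _ _] := lf.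
have b0 : 0 < p^-1 - a by rewrite subr_gt0.
have n0 : 0 <= n by rewrite -lee_fin -fn Lnorm_ge0.
have a10 : 0 < 1 - a by rewrite subr_gt0.
set b := p^-1 - a in b0 *; set M := HL_maximal f x.
have M0 : (0 <= M)%E by exact: HL_maximalT_ge0.
rewrite riesz_slab//.
have mlt : measurable_fun setT (fun r : R => r < d).
  by apply: measurable_fun_ltr => //; exact: measurable_cst.
have mgt : measurable_fun setT (fun r : R => d / 2 < r).
  by apply: measurable_fun_ltr => //; exact: measurable_cst.
pose k1 (r : R) := (pker a r * (r < d)%R%:R)%:E.
pose k2 (r : R) := (pker (- b) r * (d / 2 < r)%R%:R)%:E.
have mk1 : measurable_fun setT k1.
  by apply/measurable_EFinP; exact: measurable_pker_bool.
have mk2 : measurable_fun setT k2.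
  by apply/measurable_EFinP; exact: measurable_pker_bool.
have k10 r : (0 <= k1 r)%E by rewrite lee_fin mulr_ge0// pker_ge0.
have k20 r : (0 <= k2 r)%E by rewrite lee_fin mulr_ge0// pker_ge0.
have I1 : (\int[mu]_r k1 r = (d `^ a / a)%:E)%E.
  by rewrite integral_pker_lt// ltW.
have I2 : (\int[mu]_r k2 r = ((d / 2) `^ (- b) / b)%:E)%E.
  by rewrite integral_pker_gt// divr_gt0.
have M20 : (0 <= 2%:E * M)%E by rewrite mule_ge0.
apply: (@le_trans _ _ ((1 - a)%:E *
    \int[mu]_r (2%:E * M * k1 r + n%:E * k2 r))%E).
  apply: lee_wpmul2l; first by rewrite lee_fin ltW.
  apply: ge0_le_integral => //.
  - by move=> r _; rewrite mule_ge0 ?slab_ge0// lee_fin pker_ge0.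
  - by apply: emeasurable_funM; [apply/measurable_EFinP; exact: measurable_pker|
      exact: measurable_slab].
  - apply: emeasurable_funD; first by
      apply: emeasurable_funM => //; exact: measurable_cst.
    by apply: measurable_funeM.
  move=> r _; have [r0|r0] := ltP 0 r; last first.
    by rewrite {1}/pker (le_gtF r0) mul0e adde_ge0// mule_ge0.
  have [rd|dr] := ltP r d.
    (* The factor [r] of the maximal bound turns [r^(a-2)] into [r^(a-1)], which is integrable at
       0. *)
    apply: (@le_trans _ _ (2%:E * M * k1 r)%E); last by rewrite leeDl// mule_ge0.
    apply: (le_trans (lee_wpmul2l _ (slab_le_maximal x lf r0))).
      by rewrite lee_fin pker_ge0.
    by rewrite /k1 rd mulr1 muleA [leRHS]muleAC -!EFinM mulrCA pker_mul subrK.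
  (* Hoelder's factor turns [r^(a-2)] into [r^(-b-1)], which is integrable at infinity because
     [a < 1/p]. *)
  apply: (@le_trans _ _ (n%:E * k2 r)%E); last by rewrite leeDr// mule_ge0.
  apply: (le_trans (lee_wpmul2l _ (slab_le_Lnorm x p1 mf fn r0))).
    by rewrite lee_fin pker_ge0.
  rewrite /k2 (lt_le_trans _ dr) ?mulr1; last first.
    by rewrite ltr_pdivrMr// ltr_pMr// ltr1n.
  rewrite -!EFinM lee_fin mulrA pker_powR// mulrC.
  by rewrite (_ : a - 1 + (1 - p^-1) = - b)// /b; ring.
rewrite ge0_integralD//; last 4 first.
- by move=> r _; rewrite mule_ge0.
- by apply: emeasurable_funM => //; exact: measurable_cst.
- by move=> r _; rewrite mule_ge0.
- by apply: measurable_funeM.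
rewrite ge0_integralZl// ge0_integralZl// I1 I2.
rewrite muleDr; last 2 first.
- by [].
- by rewrite ge0_adde_def// inE mule_ge0// lee_fin divr_ge0// ?powR_ge0// ltW.
apply: leeD.
  rewrite [in leLHS]muleAC muleA -!EFinM.
  by rewrite [X in (X%:E * _)%E](_ : _ = (1 - a) * 2 / a * d `^ a)//; ring.
(* Starting the tail at [d / 2] costs the factor [2^b]. *)
rewrite -!EFinM lee_fin powRM ?invr_ge0 ?(ltW d0)//.
rewrite -[in leLHS](@powR_inv1 _ 2)// -[in leLHS]powRrM mulN1r opprK.
rewrite (_ : _ * (_ * _) = (1 - a) * 2 `^ b / b * (d `^ (- b) * n))//; ring.
Qed.

End hedberg.

(** * Hedberg's pointwise inequality *)

Section hedberg_pointwise.
Context {R : realType}.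
Local Notation mu := (@lebesgue_measure R).
Implicit Types f : R -> R.

Lemma powR_divE (c x y : R) : 0 <= x -> 0 <= y ->
  (x / y) `^ c = x `^ c * y `^ (- c).
Proof.
by move=> x0 y0; rewrite powRM ?invr_ge0// -powR_inv1// -powRrM mulN1r.
Qed.

Lemma riesz_eq0 (a : R) f x : 0 < a -> a < 1 -> measurable_fun setT f ->
  (forall r, 0 < r -> (slab f x r <= 0)%E) -> riesz a f x = 0%E.
Proof.
move=> a0 a1 mf s0; rewrite riesz_slab// integral0_eq ?mule0// => r _.
have [r0|r0] := ltP 0 r; last by rewrite /pker (le_gtF r0) mul0e.
rewrite (_ : slab f x r = 0%E) ?mule0//; apply/eqP.
by rewrite eq_le s0// slab_ge0.
Qed.

(** The exponent [q = p / (1 - a * p)] is the one for which [(M f)^(1 - a p)], raised to [q],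
    becomes [(M f)^p], whose integral the maximal inequality controls. *)
Lemma hedberg_inequality (a p : R) : 0 < a -> a < 1 -> 1 < p -> a < p^-1 ->
  exists2 C : R, 0 < C & forall f (n : R) x,
    locally_integrable setT f -> ('N[mu]_p%:E[EFin \o f] = n%:E)%E ->
    (riesz a f x `^ (p / (1 - a * p)) <=
     (C * n `^ (a * p * (p / (1 - a * p))))%:E * HL_maximal f x `^ p)%E.
Proof.
move=> a0 a1 p1 ap.
have p0 : 0 < p by exact: lt_trans p1.
have b0 : 0 < p^-1 - a by rewrite subr_gt0.
have a10 : 0 < 1 - a by rewrite subr_gt0.
have c0 : 0 < 1 - a * p by rewrite subr_gt0 -ltr_pdivlMr// div1r.
set q := p / (1 - a * p); have q0 : 0 < q by rewrite divr_gt0.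
pose C0 := (1 - a) * 2 / a + (1 - a) * 2 `^ (p^-1 - a) / (p^-1 - a).
have C00 : 0 < C0.
  by rewrite addr_gt0// divr_gt0// mulr_gt0// powR_gt0.
exists (C0 `^ q) => [|f n x lf fn]; first by rewrite powR_gt0.
have [mf _ _] := lf.
have n0 : 0 <= n by rewrite -lee_fin -fn Lnorm_ge0.
have M0 : (0 <= HL_maximal f x)%E by exact: HL_maximalT_ge0.
(* The width [(n / m)^p] used below must be positive and finite. If the norm or the maximal function
   is 0, every slab vanishes and so does the potential; if the maximal function is infinite while
   [n > 0], the right-hand side is [+oo]. *)
have R0 : riesz a f x = 0%E -> (riesz a f x `^ q <=
     (C0 `^ q * n `^ (a * p * q))%:E * HL_maximal f x `^ p)%E.
  move=> ->; rewrite poweR0r ?gt_eqF// mule_ge0 ?poweR_ge0// lee_fin.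
  by rewrite mulr_ge0// powR_ge0.
move: n0; rewrite le_eqVlt => /predU1P[n0|n0].
  apply: R0; apply: riesz_eq0 => // r r0.
  by rewrite (le_trans (slab_le_Lnorm x p1 mf fn r0))// -n0 mulr0.
have [M00|M00] := eqVneq (HL_maximal f x) 0%E.
  apply: R0; apply: riesz_eq0 => // r r0.
  by rewrite (le_trans (slab_le_maximal x lf r0))// M00 mule0.
case E : (HL_maximal f x) M0 M00 => [m||]// M0 M00; last first.
  rewrite poweRyr ?gt_eqF// gt0_muley ?leey// lte_fin mulr_gt0// powR_gt0//.
have m0 : 0 < m by rewrite lt_neqAle eq_sym; apply/andP; split.
have := @riesz_le_maximal_Lnorm _ a p n ((n / m) `^ p) f x a0 a1 p1 ap lf fn.
rewrite powR_gt0 ?divr_gt0// => /(_ erefl).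
rewrite E -EFinM -EFinD.
(* [d = (n / m)^p] balances the two terms. *)
have e1 : ((n / m) `^ p) `^ a * m = n `^ (a * p) * m `^ (1 - a * p).
  rewrite -powRrM powR_divE ?(ltW n0) ?(ltW m0)// -mulrA (mulrC p a).
  rewrite -{2}(powRr1 (ltW m0)) -powRD ?(gt_eqF m0) ?implybT//.
  by rewrite (addrC _ 1).
have e2 : ((n / m) `^ p) `^ (- (p^-1 - a)) * n = n `^ (a * p) * m `^ (1 - a * p).
  rewrite -powRrM powR_divE ?(ltW n0) ?(ltW m0)// mulrAC.
  rewrite -{2}(powRr1 (ltW n0)) -powRD ?(gt_eqF n0) ?implybT//.
  by congr (_ `^ _ * _ `^ _); field; rewrite gt_eqF.
rewrite e2 -[_ * m]mulrA e1 -mulrDl -/C0.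
move=> rle.
apply: (@le_trans _ _ ((C0 * (n `^ (a * p) * m `^ (1 - a * p)))%:E `^ q)%E).
  apply: gt0_ler_poweR => //.
  - exact: ltW.
  - by rewrite in_itv/= riesz_ge0 leey.
  - by rewrite in_itv/= leey andbT lee_fin ?mulr_ge0 ?powR_ge0// ltW.
rewrite !poweR_EFin -EFinM lee_fin powRM ?(ltW C00) ?mulr_ge0 ?powR_ge0//.
rewrite powRM ?powR_ge0// -!powRrM mulrA.
by rewrite (_ : (1 - a * p) * q = p)// /q mulrC divfK// gt_eqF.
Qed.

End hedberg_pointwise.

(** * From the pointwise inequality to Hardy-Littlewood-Sobolev, and Lebesgue differentiation *)

Section hls.
Context {R : realType}.
Local Notation mu := (@lebesgue_measure R).
Implicit Types f : R -> R.

(** On a compact set [|f|] is dominated by [1 + |f|^p], which is integrable there. *)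
Lemma locally_integrable_powR (p : R) f : 1 <= p -> measurable_fun setT f ->
  (\int[mu]_x (`|f x| `^ p)%:E < +oo)%E -> locally_integrable setT f.
Proof.
move=> p1 mf fp; split => //; first exact: openT.
move=> K _ cK; have mK := compact_measurable cK.
have mfp : measurable_fun setT (fun x => (`|f x| `^ p)%:E).
  apply/measurable_EFinP; apply: (measurableT_comp (measurable_powR p)).
  exact: measurableT_comp.
apply: (@le_lt_trans _ _ (\int[mu]_(x in K) (cst 1 x + (`|f x| `^ p)%:E))%E).
  apply: ge0_le_integral => //.
  - by apply: measurable_funTS; do 2 apply: measurableT_comp => //.
  - apply: emeasurable_funD; first exact: measurable_cst.
    exact: measurable_funTS.
  - move=> x _; rewrite -EFinD lee_fin.
    have [f1|/ltW f1] := leP `|f x| 1; first by rewrite ler_wpDr// powR_ge0.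
    by rewrite ler_wpDl// le1r_powR.
rewrite ge0_integralD//; last exact: measurable_funTS.
rewrite integral_cst// mul1e lte_add_pinfty//; first exact: compact_finite_measure.
apply: le_lt_trans fp; apply: ge0_subset_integral => //.
Qed.

Lemma Lnorm_powR (p n : R) f : 0 < p -> ('N[mu]_p%:E[EFin \o f] = n%:E)%E ->
  (\int[mu]_x (`|f x| `^ p)%:E = (n `^ p)%:E)%E.
Proof.
move=> p0 fn; rewrite -poweR_EFin -fn poweR_Lnorm ?gt_eqF//.
Qed.

Lemma hardy_littlewood_sobolev (a p : R) :
  0 < a -> a < 1 -> 1 < p -> a < p^-1 ->
  exists2 C : R, 0 < C & forall f (n : R), measurable_fun setT f ->
    ('N[mu]_p%:E[EFin \o f] = n%:E)%E ->
    (\int[mu]_x (riesz a f x `^ (p / (1 - a * p))) <=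
     (C * n `^ (p / (1 - a * p)))%:E)%E.
Proof.
move=> a0 a1 p1 ap; have p0 : 0 < p by exact: lt_trans p1.
have c0 : 0 < 1 - a * p by rewrite subr_gt0 -ltr_pdivlMr// div1r.
have [C C0 hC] := hedberg_inequality a0 a1 p1 ap.
set q := p / (1 - a * p) in hC *; have q0 : 0 < q by rewrite divr_gt0.
pose D := 6 * p * 2 `^ (p - 1) / (p - 1).
have D0 : 0 < D.
  by rewrite divr_gt0 ?subr_gt0// !mulr_gt0// powR_gt0.
exists (C * D) => [|f n mf fn]; first exact: mulr_gt0.
have Ip := Lnorm_powR p0 fn.
have lf : locally_integrable setT f.
  by apply: (locally_integrable_powR (ltW p1)) => //; rewrite Ip ltry.
have mM := measurable_HL_maximal lf.
have cn0 : 0 <= C * n `^ (a * p * q) by rewrite mulr_ge0 ?powR_ge0// ltW.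
have mpow (g : R -> \bar R) (r : R) : measurable_fun setT g ->
    measurable_fun setT (fun x => g x `^ r)%E.
  by move=> mg; exact: (measurableT_comp (measurable_poweR r) mg).
apply: (@le_trans _ _
    (\int[mu]_x ((C * n `^ (a * p * q))%:E * HL_maximal f x `^ p))%E).
  apply: ge0_le_integral => //.
  - by move=> x _; exact: poweR_ge0.
  - by apply: mpow; exact: measurable_riesz.
  - by apply: measurable_funeM; exact: mpow.
  - by move=> x _; exact: hC.
rewrite ge0_integralZl//; last 2 first.
- exact: mpow.
- by move=> x _; exact: poweR_ge0.
apply: (le_trans (lee_wpmul2l _ (strong_maximal_inequality p1 lf))) => //.
rewrite Ip -!EFinM lee_fin -/D.
(* The powers of the norm coming from Hedberg's and from the maximal inequality add up to [q],
   because [q * (1 - a * p) = p]. *)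
have -> : n `^ q = n `^ (a * p * q) * n `^ p.
  have qE : q = a * p * q + p by rewrite /q; field; rewrite gt_eqF.
  have s0 : 0 < a * p * q + p := addr_gt0 (mulr_gt0 (mulr_gt0 a0 p0) q0) p0.
  by rewrite [in LHS]qE powRD// (gt_eqF s0).
by rewrite (_ : _ * (_ * _) = C * D * (n `^ (a * p * q) * n `^ p))//; ring.
Qed.

(** At a common Lebesgue point of [u] and [w], the hypothesis on a centred interval is divided by
    its length and the radius is sent to 0. *)
Lemma ae_le_of_integral_le (u w : R -> R) :
  locally_integrable setT u -> locally_integrable setT w ->
  (forall a b : R, a < b ->
    (`|\int[mu]_(x in `]a, b[) (u x)%:E| <= \int[mu]_(x in `]a, b[) (w x)%:E)%E) ->
  {ae mu, forall x, `|u x| <= w x}.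
Proof.
move=> lu lw uw.
pose E (x : R) (n : nat) : set R := ball x n.+1%:R^-1.
have EE x n : E x n = `]x - n.+1%:R^-1, x + n.+1%:R^-1[%classic.
  by rewrite /E ball_itv.
have hE x : nicely_shrinking x (E x).
  split; first by move=> n; exact: measurable_ball.
  exists (1, fun n => PosNum (harmonic_gt0 n)); split => //=.
  - exact: cvg_harmonic.
  - by move=> n; exact: subset_refl.
  - by move=> n; rewrite mul1e.
have Lu := lebesgue_differentiation lu; have Lw := lebesgue_differentiation lw.
apply: (filterS2 _ _ Lu Lw); first exact: (ae_filter_ringOfSetsType mu).
move=> x {}Lu {}Lw.
have cu := cvg_abse (nice_lebesgue_differentiation hE lu Lu).
have cw := nice_lebesgue_differentiation hE lw Lw.
rewrite -lee_fin -abse_EFin.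
apply: (lee_cvg_to (cu _) cw); apply: nearW => n.
rewrite abseM [X in (X * _)%E]gee0_abs ?inve_ge0//.
apply: lee_wpmul2l; first by rewrite inve_ge0.
by rewrite EE; apply: uw; rewrite ltrD2l gtrN// invr_gt0.
Qed.

End hls.

(** * Norm bounds from domination by a Riesz potential *)

Section riesz_domination.
Context {R : realType}.
Local Notation mu := (@lebesgue_measure R).

(** Hardy-Littlewood-Sobolev serves twice: it makes [riesz a v] finite almost everywhere and locally
    integrable, as Lebesgue differentiation demands, and it bounds the norm of the pointwise
    majorant so obtained. *)
Lemma Lnorm_le_of_riesz (a p : R) :
  0 < a -> a < 1 -> 1 < p -> a < p^-1 ->
  exists2 C : R, 0 < C & forall (u v : R -> R) (n c : R), 0 <= c ->
    locally_integrable setT u -> measurable_fun setT v ->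
    ('N[mu]_p%:E[EFin \o v] = n%:E)%E ->
    (forall x y : R, x < y ->
      (`|\int[mu]_(t in `]x, y[) (u t)%:E| <=
       c%:E * \int[mu]_(t in `]x, y[) riesz a v t)%E) ->
    ('N[mu]_(p / (1 - a * p))%:E[EFin \o u] <= (c * C * n)%:E)%E.
Proof.
move=> a0 a1 p1 ap; have p0 : 0 < p by exact: lt_trans p1.
have c0 : 0 < 1 - a * p by rewrite subr_gt0 -ltr_pdivlMr// div1r.
have [C C0 hC] := hardy_littlewood_sobolev a0 a1 p1 ap.
set q := p / (1 - a * p) in hC *.
have q1 : 1 <= q.
  rewrite ler_pdivlMr// mul1r (le_trans _ (ltW p1))// gerBl.
  by rewrite mulr_ge0// ltW.
have q0 : 0 < q by exact: lt_le_trans q1.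
exists (C `^ q^-1) => [|u v n c c00 lu mv vn uv]; first by rewrite powR_gt0.
have n0 : 0 <= n by rewrite -lee_fin -vn Lnorm_ge0.
have {hC}hC := hC v n mv vn.
have [mu_ _ _] := lu.
have mr : measurable_fun setT (riesz a v) by exact: measurable_riesz.
have mrq : measurable_fun setT (fun x => riesz a v x `^ q)%E.
  exact: (measurableT_comp (measurable_poweR q) mr).
have ir : mu.-integrable setT (fun x => riesz a v x `^ q)%E.
  apply/integrableP; split => //.
  under eq_integral do rewrite gee0_abs ?poweR_ge0//.
  by rewrite (le_lt_trans hC)// ltry.
have rfin : {ae mu, forall x, riesz a v x \is a fin_num}.
  apply: (filterS _ (integrable_ae measurableT ir)).
  move=> x /(_ I); rewrite !ge0_fin_numE ?riesz_ge0 ?poweR_ge0// => h.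
  by apply: lty_poweRy h; rewrite gt_eqF.
(* As [fine] sends [+oo] to 0, [w] is at most the potential everywhere and equal to it almost
   everywhere. *)
pose w x := fine (riesz a v x).
have w0 x : 0 <= w x by rewrite fine_ge0// riesz_ge0.
have mw : measurable_fun setT w.
  exact: (measurableT_comp (fine_measurable measurableT) mr).
have wq x : ((w x `^ q)%:E <= riesz a v x `^ q)%E.
  rewrite /w; case: (riesz a v x) (riesz_ge0 a v x) => [r _|_|//].
    by rewrite poweR_EFin.
  by rewrite poweRyr ?gt_eqF// leey.
have mwq : measurable_fun setT (fun x => (w x `^ q)%:E).
  by apply/measurable_EFinP; exact: (measurableT_comp (measurable_powR q) mw).
have Iw : (\int[mu]_x (w x `^ q)%:E <= (C * n `^ q)%:E)%E.
  by apply: le_trans hC; apply: ge0_le_integral => // x _; rewrite lee_fin powR_ge0.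
have lw : locally_integrable setT (fun x => c * w x).
  apply: (locally_integrable_powR q1); first exact: measurable_funM.
  apply: (@le_lt_trans _ _ ((c `^ q)%:E * \int[mu]_x (w x `^ q)%:E)%E).
    rewrite -ge0_integralZl//; last 2 first.
    - by move=> x _; rewrite lee_fin powR_ge0.
    - by rewrite lee_fin powR_ge0.
    apply: ge0_le_integral => //.
    - apply/measurable_EFinP; apply: (measurableT_comp (measurable_powR q)).
      by apply: measurableT_comp => //; exact: measurable_funM.
    - exact: measurable_funeM.
    - by move=> x _; rewrite ger0_norm ?mulr_ge0// powRM// EFinM.
  rewrite (@le_lt_trans _ _ ((c `^ q)%:E * (C * n `^ q)%:E)%E) ?ltry//.
  by rewrite lee_wpmul2l// lee_fin powR_ge0.
have uw : {ae mu, forall x, `|u x| <= c * w x}.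
  apply: ae_le_of_integral_le => // x y xy.
  rewrite (le_trans (uv x y xy))//.
  under [leRHS]eq_integral do rewrite EFinM.
  rewrite ge0_integralZl//; last 2 first.
  - by apply/measurable_EFinP; exact: measurable_funTS.
  - by move=> t _; rewrite lee_fin.
  apply: lee_wpmul2l => //; rewrite le_eqVlt; apply/orP; left; apply/eqP.
  apply: ae_eq_integral => //; [exact: measurable_funTS| |].
  - by apply/measurable_EFinP; exact: measurable_funTS.
  - by apply: (@filterS _ _ (ae_filter_ringOfSetsType mu) _ _ _ rfin) => t rt _;
      rewrite /w fineK.
have Iu : (\int[mu]_x `|(EFin \o u) x| `^ q <= ((c * C `^ q^-1 * n) `^ q)%:E)%E.
  apply: (@le_trans _ _ ((c `^ q)%:E * \int[mu]_x (w x `^ q)%:E)%E).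
    rewrite -ge0_integralZl//; last 2 first.
    - by move=> x _; rewrite lee_fin powR_ge0.
    - by rewrite lee_fin powR_ge0.
    apply: ae_ge0_le_integral => //.
    - by move=> x _; exact: poweR_ge0.
    - apply: (measurableT_comp (measurable_poweR q)).
      by apply: measurableT_comp => //; exact/measurable_EFinP.
    - by move=> x _; rewrite -EFinM lee_fin mulr_ge0 ?powR_ge0.
    - exact: measurable_funeM.
    - apply: (@filterS _ _ (ae_filter_ringOfSetsType mu) _ _ _ uw) => x ux _ /=.
      rewrite -EFinM -powRM// lee_fin.
      by apply: (ge0_ler_powR (ltW q0)) => //; rewrite nnegrE mulr_ge0 ?w0.
  apply: (le_trans (lee_wpmul2l _ Iw)); first by rewrite lee_fin powR_ge0.
  rewrite -EFinM lee_fin !powRM ?mulr_ge0 ?powR_ge0//.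
  by rewrite -powRrM mulVf ?gt_eqF// powRr1 ?(ltW C0)// mulrA.
have cCn : 0 <= c * C `^ q^-1 * n by rewrite !mulr_ge0 ?powR_ge0.
rewrite unlock -[leRHS](@poweRe1 _ (c * C `^ q^-1 * n)%:E)//.
rewrite -(mulfV (lt0r_neq0 q0)) poweRrM (poweR_EFin _ q).
apply: gt0_ler_poweR => //.
- by rewrite invr_ge0 ltW.
- by rewrite in_itv/= leey andbT integral_ge0// => x _; exact: poweR_ge0.
- by rewrite in_itv/= leey andbT lee_fin powR_ge0.
Qed.

End riesz_domination.

(** * Smooth bumps *)

Section bump.
Context {R : realType}.
Local Notation mu := (@lebesgue_measure R).

(** The derivatives of [exp(-1/t)], extended by 0, are linear combinations of these functions; hence
    the powers of [t^-1]. *)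
Definition flat (k : nat) (t : R) : R :=
  if 0 < t then t^-1 ^+ k * expR (- t^-1) else 0.

Lemma flat_ge0 k t : 0 <= flat k t.
Proof.
rewrite /flat; case: ifP => // t0.
by rewrite mulr_ge0 ?expR_ge0// exprn_ge0// invr_ge0 ltW.
Qed.

(** With [s = t^-1], the exponential dominates the term [s^(k+1) / (k+1)!] of its series. One degree
    more than [k] leaves a factor [t], which gives continuity at 0. *)
Lemma flat_le k t : 0 < t -> flat k t <= k.+1`!%:R * t.
Proof.
move=> t0; rewrite /flat t0; have s0 : 0 < t^-1 by rewrite invr_gt0.
rewrite -ler_pdivrMr// mulrAC -exprSr expRN ler_pdivrMr ?expR_gt0//.
rewrite mulrC -ler_pdivrMr ?ltr0n ?fact_gt0//.
apply: le_trans (expR_ge1Dxn k (ltW s0)); exact: ler_wpDl.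
Qed.

Lemma continuous_flat0 k : {for 0, continuous (flat k)}.
Proof.
rewrite /prop_for /continuous_at {2}/flat ltxx.
apply/cvgr0Pnorm_le => e e0; near=> t.
rewrite ger0_norm ?flat_ge0//; have [t0|t0] := ltP 0 t; last first.
  by rewrite /flat (le_gtF t0) ltW.
have c0 : 0 < k.+1`!%:R :> R by rewrite ltr0n fact_gt0.
rewrite (le_trans (flat_le k t0))// mulrC -ler_pdivlMr//.
by apply/ltW; near: t; apply: lt_nbhsl; rewrite divr_gt0.
Unshelve. all: by end_near. Qed.

Lemma is_derive_flat k (x : R) :
  is_derive x 1 (flat k) (flat k.+2 x - k%:R * flat k.+1 x).
Proof.
have [x0|x0|->] := ltgtP x 0.
- rewrite /flat (lt_gtF x0) mulr0 subrr.
  apply: (@near_eq_is_derive _ _ _ (cst 0)).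
    near=> t; rewrite /flat; case: ifP => // t0.
    suff : t < 0 by rewrite ltNge ltW.
    by near: t; exact: lt_nbhsl.
- have xn0 : x != 0 by rewrite gt_eqF.
  have dV : is_derive x 1 (fun t : R => t^-1) (- x ^- 2).
    have := @is_deriveV R id x 1 1 xn0 _; rewrite /GRing.scale/= mulr1; exact.
  have d1 := @is_deriveX _ _ _ k x 1 _ dV.
  rewrite exprfctE in d1.
  have d2 := @is_derive1_comp R expR _ x _ _ (is_derive_expR (- x^-1))
    (is_deriveN dV).
  have d : is_derive x 1 (fun t => t^-1 ^+ k * expR (- t^-1))
      (flat k.+2 x - k%:R * flat k.+1 x).
    refine (is_derive_eq (is_deriveM d1 d2) _).
    rewrite /flat x0 /GRing.scale/= opprK.
    case: k {d1} => [|k]; rewrite ?expr0 ?mulr0n ?mul0r ?mulr0; first by field.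
    by rewrite !exprSr; field.
  apply: near_eq_is_derive d; near=> t; rewrite /flat ifT//.
  by near: t; exact: lt_nbhsr.
- have flat0 m : flat m 0 = 0 by rewrite /flat ltxx.
  rewrite !flat0 mulr0 subrr.
  (* At 0 the difference quotient of [flat k] is [flat k.+1], so the continuity of the latter is
     differentiability of the former. *)
  apply/is_derive1_caratheodory; exists (flat k.+1); split.
  + move=> z; rewrite flat0 !subr0 /flat; case: ifP => z0; last by rewrite mul0r.
    by rewrite exprS; field; rewrite gt_eqF.
  + exact: continuous_flat0.
  + exact: flat0.
Unshelve. all: by end_near. Qed.

(* Closed under derivation, so that its members are smooth. *)
Inductive flat_algebra : (R -> R) -> Prop :=
| flat_algebra_cst c : flat_algebra (cst c)
| flat_algebra_flat k c d : flat_algebra (fun x => flat k (c * x + d))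
| flat_algebra_add f g : flat_algebra f -> flat_algebra g -> flat_algebra (f \+ g)
| flat_algebra_mul f g : flat_algebra f -> flat_algebra g -> flat_algebra (f \* g).

Lemma flat_algebra_is_derive f : flat_algebra f ->
  exists2 g, flat_algebra g & forall x : R, is_derive x 1 f (g x).
Proof.
elim=> [c|k c d|{}f g _ [f' nf' df] _ [g' ng' dg]|
  {}f g nf [f' nf' df] ng [g' ng' dg]].
- by exists (cst 0) => [|x]; [exact: flat_algebra_cst | exact: is_derive_cst].
- exists ((cst c) \* ((fun x => flat k.+2 (c * x + d)) \+
    ((cst (- k%:R)) \* (fun x => flat k.+1 (c * x + d)))))%R.
    by apply: flat_algebra_mul; [exact: flat_algebra_cst|
      apply: flat_algebra_add; [exact: flat_algebra_flat|
      apply: flat_algebra_mul; [exact: flat_algebra_cst|exact: flat_algebra_flat]]].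
  move=> x.
  have da : is_derive x 1 (fun x : R => c * x + d) c.
    rewrite -[X in is_derive _ _ _ X](addr0 c); apply: is_deriveD.
    by rewrite -[X in is_derive _ _ _ X]mulr1; exact: is_deriveZ.
  refine (is_derive_eq (@is_derive1_comp R (flat k) (fun x => c * x + d) x _ _
    (is_derive_flat k (c * x + d)) da) _).
  by rewrite /= mulNr mulrC.
- exists (f' \+ g')%R; first exact: flat_algebra_add.
  by move=> x; exact: is_deriveD.
- exists (f \* g' \+ g \* f')%R.
    by apply: flat_algebra_add; exact: flat_algebra_mul.
  by move=> x; exact: is_deriveM.
Qed.

Lemma flat_algebra_derive1 f : flat_algebra f ->
  flat_algebra (derive1 f) /\ forall x : R, derivable f x 1.
Proof.
move=> /flat_algebra_is_derive[g ng dg]; split; last first.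
  by move=> x; case: (dg x).
rewrite (_ : derive1 f = g)//; apply/funext => x.
by rewrite derive1E; case: (dg x).
Qed.

Lemma flat_algebra_derivable f n (x : R) : flat_algebra f -> derivable (derive1n n f) x 1.
Proof.
move=> nf; suff : flat_algebra (derive1n n f) by move=> /flat_algebra_derive1[].
by elim: n => // n ih; rewrite derive1nS; case: (flat_algebra_derive1 ih).
Qed.

(** Each factor is [exp(-1/((n+1) d))], with [d] the distance to one end of the interval, and it
    tends to 1 for [d > 0]. The arguments are written as [c * x + d] to fit [flat_algebra]. *)
Definition bump (a b : R) (n : nat) : R -> R :=
  (fun x => flat 0 (n.+1%:R * x + - (n.+1%:R * a))) \*
  (fun x => flat 0 (- n.+1%:R * x + n.+1%:R * b)).

Lemma bumpE a b n x :
  bump a b n x = flat 0 (n.+1%:R * (x - a)) * flat 0 (n.+1%:R * (b - x)).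
Proof. by rewrite /bump/=; congr (flat 0 _ * flat 0 _); ring. Qed.

Lemma bump_ge0 a b n x : 0 <= bump a b n x.
Proof. by rewrite mulr_ge0// flat_ge0. Qed.

Lemma flat0_le1 t : flat 0 t <= 1.
Proof.
rewrite /flat; case: ifP => // t0; rewrite expr0 mul1r -expR0 ler_expR.
by rewrite oppr_le0 invr_ge0 ltW.
Qed.

Lemma bump_le1 a b n x : bump a b n x <= 1.
Proof. by rewrite mulr_ile1 ?flat_ge0 ?flat0_le1. Qed.

Lemma bump_eq0 a b n x : x \notin `]a, b[ -> bump a b n x = 0.
Proof.
rewrite in_itv/= negb_and -!leNgt bumpE => /orP[xa|bx].
  by rewrite [flat 0 _]/flat pmulr_rgt0// subr_gt0 (le_gtF xa) mul0r.
by rewrite mulrC [flat 0 _]/flat pmulr_rgt0// subr_gt0 (le_gtF bx) mul0r.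
Qed.

Lemma test_function_bump a b n : test_function (bump a b n).
Proof.
split.
  by move=> m x; apply: flat_algebra_derivable; apply: flat_algebra_mul;
    exact: flat_algebra_flat.
apply: (subclosed_compact _ (@segment_compact R a b)).
  exact: closed_closure.
have cab := compact_closed (@Rhausdorff R) (@segment_compact R a b).
rewrite [X in _ `<=` X](proj1 (closure_id _) cab).
apply: closureS => x /=; apply: contra_neqT => xab.
apply: bump_eq0; apply: contra xab => /subset_itv_oo_cc; exact.
Qed.

Lemma flat0_cvg t : 0 < t -> flat 0 (n.+1%:R * t) @[n --> \oo] --> (1 : R).
Proof.
move=> t0; under eq_fun do rewrite /flat mulr_gt0// expr0 mul1r invfM.
have : expR (- (n.+1%:R^-1 * t^-1)) @[n --> \oo] --> expR (0 : R).
  apply: continuous_cvg; first exact: continuous_expR.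
  have -> : 0 = - (0 * t^-1) :> R by rewrite mul0r oppr0.
  by apply: cvgN; apply: cvgMl; exact: cvg_harmonic.
by rewrite expR0.
Qed.

Lemma bump_cvg a b x : bump a b n x @[n --> \oo] --> (\1_`]a, b[ x : R).
Proof.
rewrite indicE mem_setE; case: (boolP (x \in _)) => [|xab]; last first.
  have -> : (bump a b ^~ x) = (fun=> 0).
    by apply/funext => n; exact: bump_eq0.
  exact: cvg_cst.
rewrite in_itv/= => /andP[ax xb].
under eq_fun do rewrite bumpE.
rewrite -subr_gt0 in ax; rewrite -subr_gt0 in xb.
by have := cvgM (flat0_cvg ax) (flat0_cvg xb); rewrite mulr1; exact.
Qed.

Lemma measurable_bump a b n : measurable_fun setT (bump a b n).
Proof.
have [] := test_function_bump a b n => /(_ 0) d _.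
apply: continuous_measurable_fun => x; apply: differentiable_continuous.
exact/derivable1_diffP/d.
Qed.

Lemma integral_bump_cvg (a b : R) (f : R -> R) :
  mu.-integrable setT (EFin \o f) ->
  (\int[mu]_x (f x * bump a b n x)%:E @[n --> \oo] -->
   \int[mu]_(x in `]a, b[) (f x)%:E)%E.
Proof.
move=> intf; have /measurable_EFinP mf := measurable_int _ intf.
rewrite [X in _ --> X]integral_mkcond.
suff [_ _] : [/\ mu.-integrable setT (EFin \o (f \_ `]a, b[)),
  [sequence \int[mu]_x `|(f x * bump a b n x)%:E - (f \_ `]a, b[ x)%:E| ]_n
     @ \oo --> 0 &
  [sequence \int[mu]_x (f x * bump a b n x)%:E ]_n @ \oo -->
    \int[mu]_x (f \_ `]a, b[ x)%:E ]%E.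
  by rewrite [in X in _ -> X]restrict_EFin.
apply: (@dominated_convergence _ _ _ mu setT measurableT
  (fun n x => (f x * bump a b n x)%:E) (EFin \o (f \_ `]a, b[))
  (abse \o (EFin \o f))).
- move=> n; apply/measurable_EFinP; apply: measurable_funM => //.
  exact: measurable_bump.
- apply/measurable_EFinP; apply/(measurable_restrictT _ _).1 => //.
  exact: measurable_funTS.
- apply: aeW => x _; apply: cvg_EFin; first exact: nearW.
  have -> : (f \_ `]a, b[) x = f x * \1_(`]a, b[) x.
    by rewrite patchE indicE; case: ifPn; rewrite ?mulr1 ?mulr0.
  by apply: cvgMr; exact: bump_cvg.
- exact: integrable_abse.
- apply: aeW => x n _; rewrite /= lee_fin normrM ler_piMr//.
  by rewrite ger0_norm ?bump_ge0// bump_le1.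
Qed.

End bump.

(** * Beta and gamma integrals *)

Section beta.
Context {R : realType}.
Local Notation mu := (@lebesgue_measure R).

Lemma pker_scale (s z t : R) : 0 < z -> pker s (z * t) = z `^ (s - 1) * pker s t.
Proof.
move=> z0; rewrite /pker pmulr_rgt0//; case: ifP => [t0|_]; last by rewrite mulr0.
by rewrite powRM// ltW.
Qed.

Lemma pker_le_inv (s t : R) : 0 <= s -> 0 < t -> t <= 1 -> pker s t <= t^-1.
Proof.
move=> s0 t0 t1; rewrite /pker t0 -opprB powRN lef_pV2 ?posrE ?powR_gt0//.
by apply: ger1_powR; rewrite ?t0// gerBl.
Qed.

Lemma pker_ge1 (s t : R) : s <= 1 -> 0 < t -> t <= 1 -> 1 <= pker s t.
Proof.
move=> s1 t0 t1; rewrite /pker t0 -opprB powRN invf_ge1 ?powR_gt0//.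
by rewrite -[leRHS](powRr0 t); apply: ger_powR; rewrite ?t0 ?t1 ?subr_ge0.
Qed.

Lemma pker_le1 (s t : R) : s <= 1 -> 1 <= t -> pker s t <= 1.
Proof.
move=> s1 t1; rewrite /pker (lt_le_trans ltr01 t1).
by rewrite -[leRHS](powRr0 t); apply: ler_powR => //; rewrite subr_le0.
Qed.

Lemma measurable_beta_fun (a z : R) :
  measurable_fun setT (fun r : R => (pker a r * pker (1 - a) (z - r))%:E).
Proof.
apply/measurable_EFinP; apply: measurable_funM; first exact: measurable_pker.
by apply: measurable_pker_comp; exact: measurable_funB.
Qed.

(* On [0 < r < 1] one of [r], [1 - r] is at least 1/2, so one of the two factors
   is at most 2. *)
Lemma beta_pker1 (a : R) : 0 < a -> a < 1 -> exists2 b : R, 1 <= b &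
  (\int[mu]_r (pker a r * pker (1 - a) (1 - r))%:E = b%:E)%E.
Proof.
move=> a0 a1; have a10 : 0 < 1 - a by rewrite subr_gt0.
pose k (s r : R) : \bar R := (pker s r * (r < 1)%R%:R)%:E.
have mk s : measurable_fun setT (k s).
  apply/measurable_EFinP; apply: measurable_funM; first exact: measurable_pker.
  by apply: measurable_bool_natr; apply: measurable_fun_ltr => //; exact: measurable_cst.
have k0 s r : (0 <= k s r)%E by rewrite lee_fin mulr_ge0// pker_ge0.
have mk1 s : measurable_fun setT (fun r : R => k s (1 - r)).
  by apply: (measurableT_comp (mk s)); exact: measurable_funB.
have mkk : measurable_fun setT (fun r : R => k a r + k (1 - a)%R (1 - r)%R)%E.
  by apply: emeasurable_funD; [exact: mk|exact: mk1].
have fin : (\int[mu]_r (pker a r * pker (1 - a) (1 - r))%:E < +oo)%E.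
  apply: (@le_lt_trans _ _
      (2%:E * \int[mu]_r (k a r + k (1 - a)%R (1 - r)%R))%E); last first.
    have I1 : (\int[mu]_r k a r = (1 `^ a / a)%:E)%E.
      exact: integral_pker_lt.
    have I2 : (\int[mu]_r k (1 - a)%R (1 - r)%R = (1 `^ (1 - a) / (1 - a))%:E)%E.
      by rewrite (ge0_integral_rev 1 (mk _) (k0 _)) integral_pker_lt.
    have -> : (\int[mu]_r (k a r + k (1 - a)%R (1 - r)%R) =
        (1 `^ a / a + 1 `^ (1 - a) / (1 - a))%:E)%E.
      by rewrite EFinD -I1 -I2; apply: ge0_integralD => //; [exact: mk|exact: mk1].
    by rewrite -EFinM ltry.
  rewrite -ge0_integralZl//; last by move=> r _; exact: adde_ge0.
  apply: ge0_le_integral => //.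
  - by move=> r _; rewrite lee_fin mulr_ge0// pker_ge0.
  - exact: measurable_beta_fun.
  - by apply: measurable_funeM; exact: mkk.
  move=> r _; rewrite /k -EFinD -EFinM lee_fin.
  have [r0|r0] := ltP 0 r; last first.
    by rewrite (_ : pker a r = 0) ?mul0r ?add0r ?mulr_ge0 ?pker_ge0//
      /pker (le_gtF r0).
  have [r1|r1] := ltP r 1; last first.
    rewrite (_ : pker (1 - a) (1 - r) = 0) ?mulr0 ?mul0r ?mulr_ge0//.
    by rewrite /pker subr_gt0 (le_gtF r1).
  rewrite gtrBl r0 !mulr1.
  have h (x y : R) : 0 <= x -> 0 <= y -> x <= 2 \/ y <= 2 -> x * y <= 2 * (x + y).
    by move=> x0 y0 [h|h]; nra.
  apply: h; rewrite ?pker_ge0//.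
  have [r2|r2] := leP r 2^-1.
    right; apply: (le_trans (pker_le_inv _ _ _)); rewrite ?subr_gt0 ?(ltW a10)//.
      by rewrite gerBl ltW.
    rewrite invf_ple ?posrE ?subr_gt0//; lra.
  left; apply: (le_trans (pker_le_inv _ _ _)); rewrite ?(ltW a0) ?(ltW r1)//.
  by rewrite invf_ple ?posrE ?subr_gt0// ltW.
(* Both kernels are at least 1 on []0, 1[]; this makes [b] positive, hence a legitimate divisor
   later. *)
have b1 : (1 <= \int[mu]_r (pker a r * pker (1 - a) (1 - r))%:E)%E.
  have -> : 1%E = (\int[mu]_(r in `]0%R, 1%R[) (cst 1%E r))%E :> \bar R.
    by rewrite integral_cst//= lebesgue_measure_itv/= lte_fin ltr01 mul1e -EFinB subr0.
  rewrite integral_mkcond; apply: ge0_le_integral => //.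
  - by move=> r _; rewrite patchE; case: ifP.
  - by apply/(measurable_restrictT _ _).1.
  - exact: measurable_beta_fun.
  - move=> r _; rewrite patchE; case: ifPn => [|_]; last first.
      by rewrite lee_fin mulr_ge0// pker_ge0.
    rewrite inE/= in_itv/= => /andP[r0 r1]; rewrite lee_fin.
    rewrite -[leLHS]mulr1; apply: ler_pM => //.
      by apply: pker_ge1; rewrite // ltW.
    by apply: pker_ge1; rewrite ?subr_gt0// gerBl ltW.
have fb : (\int[mu]_r (pker a r * pker (1 - a) (1 - r))%:E)%E \is a fin_num.
  by rewrite ge0_fin_numE//; apply: (le_trans _ b1).
by exists (fine (\int[mu]_r (pker a r * pker (1 - a) (1 - r))%:E)%E);
  rewrite -?lee_fin fineK.
Qed.

(** The two kernels are homogeneous of degrees [a - 1] and [- a], so the Jacobian of [r -> z * r]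
    cancels all powers of [z]: their convolution is a multiple of the Heaviside function. *)
Lemma beta_pker (a : R) : 0 < a -> a < 1 -> exists2 b : R, 1 <= b &
  forall z, (\int[mu]_r (pker a r * pker (1 - a) (z - r))%:E =
    (b * (0 < z)%R%:R)%:E)%E.
Proof.
move=> a0 a1; have [b b1 bE] := beta_pker1 a0 a1; exists b => // z.
have [z0|z0] := ltP 0 z; last first.
  rewrite mulr0 integral0_eq// => r _; rewrite /pker subr_gt0.
  by have [r0|r0] := ltP 0 r; rewrite ?mul0r// (le_gtF (le_trans z0 (ltW r0))) mulr0.
rewrite -(@ge0_integral_affine _ z 0 (fun r => (pker a r * pker (1 - a) (z - r))%:E))//;
  last 2 first.
- exact: measurable_beta_fun.
- by move=> r; rewrite lee_fin mulr_ge0// pker_ge0.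
rewrite mulr1 -bE -ge0_integralZl//; last 3 first.
- apply: (measurableT_comp (measurable_beta_fun a z)).
  by apply: measurable_funD => //; exact: measurable_funM.
- by move=> r _; rewrite lee_fin mulr_ge0// pker_ge0.
- by rewrite lee_fin ltW.
apply: eq_integral => r _; rewrite addr0.
rewrite (_ : z - z * r = z * (1 - r)); last by ring.
rewrite !pker_scale// -EFinM; congr EFin.
rewrite mulrACA mulrA -powRD ?(gt_eqF z0) ?implybT//.
rewrite (_ : a - 1 + (1 - a - 1) = -1); last by ring.
by rewrite powR_inv1 ?(ltW z0)// !mulrA mulfV ?mul1r// gt_eqF.
Qed.

(** Since [Rintegral] is 0 on a divergent integral, positivity requires an upper bound as well as a
    lower one. *)
Lemma Gamma_gt0 (s : R) : 0 < s -> s <= 1 -> 0 < Gamma s.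
Proof.
move=> s0 s1; rewrite /Gamma /Rintegral.
pose f (t : R) := pker s t * expR (- t).
have mf : measurable_fun setT (fun t : R => (f t)%:E).
  apply/measurable_EFinP; apply: measurable_funM; first exact: measurable_pker.
  exact: measurableT_comp.
have f0 t : (0 <= (f t)%:E)%E by rewrite lee_fin mulr_ge0// ?pker_ge0// expR_ge0.
have -> : (\int[mu]_(t in `]0%R, +oo[) (t `^ (s - 1) * expR (- t))%:E =
    \int[mu]_t (f t)%:E)%E.
  rewrite integral_mkcond; apply: eq_integral => t _.
  rewrite patchE mem_setE in_itv/= andbT /f /pker.
  by case: ifP => //; rewrite mul0r.
apply: fine_gt0; apply/andP; split.
- apply: (@lt_le_trans _ _ (\int[mu]_(r in `]0%R, 1%R[) (cst (expR (- 1))%:E r))%E).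
    rewrite integral_cst//= lebesgue_measure_itv/= lte_fin ltr01 -EFinB subr0 mule1.
    by rewrite lte_fin expR_gt0.
  rewrite integral_mkcond; apply: ge0_le_integral => //.
  - by move=> r _; rewrite patchE; case: ifP => // _; rewrite lee_fin expR_ge0.
  - by apply/(measurable_restrictT _ _).1.
  - move=> r _; rewrite patchE; case: ifPn => // .
    rewrite inE/= in_itv/= => /andP[r0 r1]; rewrite lee_fin.
    rewrite -[leLHS]mul1r; apply: ler_pM; rewrite ?expR_ge0//.
      by apply: pker_ge1 => //; rewrite ltW.
    by rewrite ler_expR lerN2 ltW.
(* The integrand is at most [t^(s-1)] for [t < 1] and at most [2 t^(-2)] for [t >= 1], by
   [e^t >= t^2 / 2]. The second region is enlarged to [1/2 < t] so that a strict inequality includes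
   [t = 1]. *)
- pose g1 (t : R) := (pker s t * (t < 1)%R%:R)%:E.
  pose g2 (t : R) := (pker (- 1) t * (2^-1 < t)%R%:R)%:E.
  have mg1 : measurable_fun setT g1.
    apply/measurable_EFinP; apply: measurable_funM; first exact: measurable_pker.
    by apply: measurable_bool_natr; apply: measurable_fun_ltr => //;
      exact: measurable_cst.
  have mg2 : measurable_fun setT g2.
    apply/measurable_EFinP; apply: measurable_funM; first exact: measurable_pker.
    by apply: measurable_bool_natr; apply: measurable_fun_ltr => //;
      exact: measurable_cst.
  have g10 t : (0 <= g1 t)%E by rewrite lee_fin mulr_ge0// pker_ge0.
  have g20 t : (0 <= g2 t)%E by rewrite lee_fin mulr_ge0// pker_ge0.
  apply: (@le_lt_trans _ _ (\int[mu]_t (g1 t + 2%:E * g2 t))%E); last first.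
    rewrite ge0_integralD//; last 2 first.
    - by move=> t _; rewrite mule_ge0.
    - exact: measurable_funeM.
    rewrite ge0_integralZl// integral_pker_lt// integral_pker_gt//.
    by rewrite -EFinM -EFinD ltry.
  apply: ge0_le_integral => //.
  - by apply: emeasurable_funD => //; exact: measurable_funeM.
  move=> t _; rewrite /g1 /g2 -EFinM -EFinD lee_fin /f.
  have [t0|t0] := ltP 0 t; last first.
    by rewrite {1}/pker (le_gtF t0) mul0r addr_ge0// ?mulr_ge0// pker_ge0.
  have [t1|t1] := ltP t 1.
    rewrite mulr1 ler_wpDr ?mulr_ge0// ?pker_ge0// ler_piMr ?pker_ge0//.
    by rewrite -expR0 ler_expR oppr_le0 ltW.
  rewrite mulr0 add0r (lt_le_trans _ t1) ?invf_lt1 ?ltr1n// mulr1.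
  apply: (@le_trans _ _ (expR (- t))).
    by rewrite ler_piMl ?expR_ge0// pker_le1.
  rewrite expRN /pker t0 (_ : - 1 - 1 = - 2%:R); last by ring.
  rewrite powR_invn ?(ltW t0)// invf_ple ?posrE ?expR_gt0 ?mulr_gt0 ?invr_gt0
    ?exprn_gt0//.
  rewrite invfM invrK (le_trans _ (expR_ge1Dxn 1 (ltW t0)))//.
  by rewrite ler_wpDl// mulrC.
Qed.

End beta.

(** * Fractional derivatives of test functions *)

Section weyl.
Context {R : realType}.
Local Notation mu := (@lebesgue_measure R).

Definition bounded_support (h : R -> R) (L M : R) : Prop :=
  [/\ measurable_fun setT h, forall x, `|h x| <= M &
      forall x, L < `|x| -> h x = 0].

Lemma test_function_derive1 (phi : R -> R) :
  test_function phi -> test_function (derive1 phi).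
Proof.
move=> [dphi cphi]; split.
  by move=> n x; have := dphi n.+1 x; rewrite derive1Sn.
apply: (subclosed_compact _ cphi); first exact: closed_closure.
set K := closure [set x | phi x != 0].
have cK : closed K by exact: closed_closure.
rewrite [X in _ `<=` X](proj1 (closure_id _) cK); apply: closureS => x /= dx.
apply: contrapT => xK; move/eqP: dx; apply.
have nx : \forall y \near x, phi y = (cst 0) y.
  have : nbhs x (~` K) by apply: open_nbhs_nbhs; split => //; exact: closed_openC.
  apply: filterS => y yK; apply: contrapT => /eqP py; apply: yK.
  exact: subset_closure.
by rewrite derive1E (near_eq_derive _ nx) derive_cst.
Qed.

Lemma test_function_continuous (phi : R -> R) :
  test_function phi -> continuous phi.
Proof.
move=> [d _] x; apply: differentiable_continuous; apply/derivable1_diffP.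
exact: (d 0).
Qed.

Lemma test_function_bounded_support (phi : R -> R) : test_function phi ->
  exists L M : R, [/\ 0 <= L, 0 <= M & bounded_support phi L M].
Proof.
move=> tphi; have cphi := test_function_continuous tphi.
have [_ /compact_bounded[L [_ hL]]] := tphi.
pose L1 := `|L| + 1.
have L10 : 0 <= L1 by rewrite addr_ge0.
have phi0 x : L1 < `|x| -> phi x = 0.
  move=> Lx; apply/eqP; apply: contraTT Lx => px; rewrite -leNgt.
  apply: (hL L1); first by rewrite (le_lt_trans (ler_norm L))// ltrDl.
  exact: subset_closure.
have [||c _ cmax] := @EVT_max R (fun x => `|phi x|) (- L1) L1.
- by rewrite -subr_ge0 opprK addr_ge0.
- apply: continuous_subspaceT => x; apply: continuous_comp; first exact: cphi.
  exact: norm_continuous.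
exists L1, `|phi c|; split => //; split.
- exact: continuous_measurable_fun.
- move=> x; have [xL|Lx] := leP `|x| L1; last by rewrite phi0// normr0.
  by apply: cmax; rewrite in_itv/= -ler_norml.
- exact: phi0.
Qed.

(** [Gamma s] times the right fractional integral of order [s], shifted so that [x] occurs in [h]
    only and differentiation spares the singular kernel. *)
Definition weyl (s : R) (h : R -> R) (x : R) : R :=
  \int[mu]_t (pker s t * h (x + t)).

Lemma integrable_pker_lt (s b M : R) : 0 < s -> 0 <= b ->
  mu.-integrable setT (fun t : R => (M * (pker s t * (t < b)%R%:R))%:E).
Proof.
move=> s0 b0.
under eq_fun do rewrite EFinM; apply: integrableZl => //.
apply/integrableP; split.
  apply/measurable_EFinP; apply: measurable_pker_bool.
  by apply: measurable_fun_ltr => //; exact: measurable_cst.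
under eq_integral do rewrite gee0_abs ?lee_fin ?mulr_ge0 ?pker_ge0//.
by rewrite integral_pker_lt// ltry.
Qed.

Lemma measurable_weyl_fun (s x : R) h : measurable_fun setT h ->
  measurable_fun setT (fun t : R => pker s t * h (x + t)).
Proof.
move=> mh; apply: measurable_funM; first exact: measurable_pker.
by apply: (measurableT_comp mh); exact: measurable_funD.
Qed.

(** The majorant depends on [x] only through [L - x < T], so one [T] serves a whole neighbourhood,
    as differentiation under the integral sign requires. *)
Lemma weyl_fun_le (s L M x T t : R) h : 0 < s -> bounded_support h L M -> L - x < T ->
  `|pker s t * h (x + t)| <= M * (pker s t * (t < T)%R%:R).
Proof.
move=> s0 [mh hM hL] LT; have M0 : 0 <= M by exact: le_trans (hM 0).
rewrite normrM ger0_norm ?pker_ge0// mulrCA ler_wpM2l ?pker_ge0//.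
have [tT|Tt] := ltP t T; first by rewrite mulr1.
rewrite mulr0 hL ?normr0//; apply: lt_le_trans (ler_norm _).
by rewrite -ltrBlDl (lt_le_trans LT).
Qed.

Lemma integrable_weyl (s L M x : R) h : 0 < s -> bounded_support h L M ->
  mu.-integrable setT (fun t : R => (pker s t * h (x + t))%:E).
Proof.
move=> s0 hb; have [mh hM hL] := hb.
have M0 : 0 <= M by exact: le_trans (hM 0).
pose T := `|L - x| + 1.
have T0 : 0 <= T by rewrite addr_ge0.
have LT : L - x < T by rewrite (le_lt_trans (ler_norm _))// ltrDl.
apply: le_integrable (integrable_pker_lt M s0 T0) => //.
- by apply/measurable_EFinP; exact: measurable_weyl_fun.
- move=> t _; rewrite /= lee_fin (le_trans (weyl_fun_le t s0 hb LT))//.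
  exact: ler_norm.
Qed.

Lemma integral_bounded_support_lty (L M : R) h : bounded_support h L M ->
  (\int[mu]_x (`|h x|)%:E < +oo)%E.
Proof.
move=> [mh hM hL]; have M0 : 0 <= M by exact: le_trans (hM 0).
apply: (@le_lt_trans _ _ (\int[mu]_(x in `[(- L)%R, L]) (cst M%:E x))%E); last first.
  rewrite integral_cst//= lebesgue_measure_itv/=; case: ifPn => _.
    by rewrite -EFinB -EFinM ltry.
  by rewrite mule0.
rewrite [leRHS]integral_mkcond; apply: ge0_le_integral => //.
- by apply/measurable_EFinP; exact: measurableT_comp.
- by apply/(measurable_restrictT _ _).1.
- move=> x _; rewrite patchE mem_setE in_itv/= -ler_norml.
  have [xL|Lx] := leP `|x| L; first by rewrite lee_fin.
  by rewrite (hL _ Lx) normr0.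
Qed.

(** The integral is split at [t = 1]: below, [|h| <= M] and the kernel integrates to [1 / s]; above,
    the kernel is at most 1 and [h] is integrable. *)
Lemma weyl_bounded (s L M : R) h : 0 < s -> s <= 1 -> bounded_support h L M ->
  exists K, forall x, `|weyl s h x| <= K.
Proof.
move=> s0 s1 hb; have [mh hM hL] := hb.
have M0 : 0 <= M by exact: le_trans (hM 0).
have hfin := integral_bounded_support_lty hb.
pose K : \bar R := ((M / s)%:E + \int[mu]_x (`|h x|)%:E)%E.
exists (fine K) => x.
have Kfin : K \is a fin_num.
  by rewrite fin_numD//= ge0_fin_numE// integral_ge0.
rewrite -lee_fin fineK// -abse_EFin /weyl /Rintegral.
rewrite fineK; last first.
  exact: (integrable_fin_num measurableT (integrable_weyl x s0 hb)).
apply: (le_trans (le_abse_integral _ _ _)) => //.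
  by apply/measurable_EFinP; exact: measurable_weyl_fun.
have mk : measurable_fun setT (fun t : R => (M * (pker s t * (t < 1)%R%:R))%:E).
  by have /integrableP[] := @integrable_pker_lt s 1 M s0 ler01.
have mhx : measurable_fun setT (fun t : R => (`|h (t + x)|)%:E).
  apply/measurable_EFinP; apply: measurableT_comp => //.
  by apply: (measurableT_comp mh); exact: measurable_funD.
apply: (@le_trans _ _ (\int[mu]_t ((M * (pker s t * (t < 1)%R%:R))%:E +
    (`|h (t + x)|)%:E))%E).
  apply: ge0_le_integral => //.
  - apply: measurableT_comp => //.
    by apply/measurable_EFinP; exact: measurable_weyl_fun.
  - by apply: emeasurable_funD.
  - move=> t _; rewrite abse_EFin -EFinD lee_fin [leRHS]addrC normrM.
    rewrite ger0_norm ?pker_ge0// (addrC t x).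
    have [t1|t1] := ltP t 1.
      by rewrite mulr1 ler_wpDl// mulrC ler_wpM2r ?pker_ge0.
    by rewrite !mulr0 addr0 ler_piMl// pker_le1.
rewrite ge0_integralD//; last first.
  by move=> t _; rewrite lee_fin !mulr_ge0// pker_ge0.
rewrite /K; apply: leeD.
  rewrite le_eqVlt; apply/orP; left; apply/eqP.
  transitivity (M%:E * \int[mu]_t (pker s t * (t < 1)%R%:R)%:E)%E.
    rewrite -ge0_integralZl//.
    - apply/measurable_EFinP; apply: measurable_pker_bool.
      by apply: measurable_fun_ltr => //; exact: measurable_cst.
    - by move=> t _; rewrite lee_fin mulr_ge0// pker_ge0.
  by rewrite integral_pker_lt// powR1 mul1r -EFinM.
rewrite (@ge0_integral_shift _ x (fun t => (`|h t|)%:E))//.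
by apply/measurable_EFinP; exact: measurableT_comp.
Qed.

Lemma is_derive_weyl (s x : R) phi : 0 < s -> test_function phi ->
  is_derive x 1 (weyl s phi) (weyl s (derive1 phi) x).
Proof.
move=> s0 tphi; have [dphi _] := tphi.
have [L [M [L0 M0 hb]]] := test_function_bounded_support tphi.
have [L' [M' [L'0 M'0 hb']]] :=
  test_function_bounded_support (test_function_derive1 tphi).
(* Adapted to the left end of the neighbourhood []x - 1, x + 1[], where the support of the translate
   reaches furthest. *)
pose T := `|L' - (x - 1)| + 1.
have T0 : 0 <= T by rewrite addr_ge0.
pose f (y t : R) := pker s t * phi (y + t).
have d (y t : R) : is_derive y 1 (f ^~ t) (pker s t * derive1 phi (y + t)).
  have dp : is_derive (y + t) 1 phi (derive1 phi (y + t)).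
    by apply: DeriveDef; [exact: (dphi 0)|rewrite derive1E].
  have ds : is_derive y 1 (fun y : R => y + t) (1 : R).
    by rewrite -[X in is_derive _ _ _ X]addr0; apply: is_deriveD.
  have := @is_derive1_comp R phi (fun y => y + t) y _ _ dp ds.
  by rewrite mulr1 => dc; exact: (is_deriveZ (pker s t) dc).
have d1 (y t : R) : (partial1of2 f) y t = pker s t * derive1 phi (y + t).
  by rewrite partial1of2E; case: (d y t).
have xI : `](x - 1), (x + 1)[%classic x.
  by rewrite /= in_itv/= ltrBlDr !ltrDl ltr01.
have intf (y : R) : `](x - 1), (x + 1)[%classic y ->
    mu.-integrable setT (EFin \o f y).
  by move=> _; exact: integrable_weyl hb.
have derf1 (y t : R) : `](x - 1), (x + 1)[%classic y -> setT t ->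
    derivable (f ^~ t) y 1.
  by move=> _ _; case: (d y t).
have G0 (t : R) : 0 <= M' * (pker s t * (t < T)%R%:R).
  by rewrite !mulr_ge0// pker_ge0.
have Gub (y t : R) : `](x - 1), (x + 1)[%classic y -> setT t ->
    `|(partial1of2 f) y t| <= M' * (pker s t * (t < T)%R%:R).
  rewrite /= in_itv/= => /andP[xy _] _; rewrite d1.
  apply: (weyl_fun_le t s0 hb'); apply: (@le_lt_trans _ _ `|L' - (x - 1)|).
    by rewrite (le_trans _ (ler_norm _))// lerD2l lerN2 ltW.
  by rewrite ltrDl.
have D := derivable_under_integral measurableT xI intf derf1 G0
  (integrable_pker_lt M' s0 T0) Gub.
have E := differentiation_under_integral measurableT xI intf derf1 G0
  (integrable_pker_lt M' s0 T0) Gub.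
apply: DeriveDef; first exact: D.
rewrite -derive1E E /weyl; apply: eq_Rintegral => t _; exact: d1.
Qed.

Lemma fracI_plusE (s x : R) (f : R -> R) : measurable_fun setT f ->
  fracI plus s f x = (Gamma s)^-1 * weyl s f x.
Proof.
move=> mf; rewrite /fracI /weyl /Rintegral; congr (_ * fine _).
rewrite integral_mkcond.
pose g (y : R) := (pker s (y - x) * f y)%:E.
transitivity (\int[mu]_y g y)%E.
  apply: eq_integral => y _; rewrite patchE mem_setE in_itv/= andbT /g /pker.
  rewrite subr_gt0; case: ifP => xy; last by rewrite mul0r.
  by rewrite mulrC -powRN opprB.
rewrite -(@integral_shift _ x g).
  by apply: eq_integral => t _; rewrite /g addrK addrC.
apply/measurable_EFinP; apply: measurable_funM => //.
by apply: measurable_pker_comp; exact: measurable_funB.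
Qed.

Lemma fracD_plusE (a x : R) phi : a < 1 -> test_function phi ->
  fracD plus a phi x = - ((Gamma (1 - a))^-1 * weyl (1 - a) (derive1 phi) x).
Proof.
move=> a1 tphi; have a10 : 0 < 1 - a by rewrite subr_gt0.
rewrite /fracD; congr (- _).
have mphi := continuous_measurable_fun (test_function_continuous tphi).
rewrite (_ : fracI plus (1 - a) phi =
  (Gamma (1 - a))^-1 \*: weyl (1 - a) phi); last first.
  by apply/funext => y; rewrite fracI_plusE.
have d := is_deriveZ (Gamma (1 - a))^-1 (is_derive_weyl x a10 tphi).
by rewrite derive1E; case: d.
Qed.

End weyl.

(** * Composition of fractional integrals of orders [a] and [1 - a] *)

Section semigroup.
Context {R : realType}.
Local Notation mu := (@lebesgue_measure R).
Local Notation RR := (measurableTypeR R).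

Lemma integral_derive1_test (x : R) phi : test_function phi ->
  (\int[mu]_z ((0 < z)%R%:R * derive1 phi (x + z))%:E = (- phi x)%:E)%E.
Proof.
move=> tphi; have tphi' := test_function_derive1 tphi.
have [dphi _] := tphi.
have [L [M [L0 M0 [mphi phiM phiL]]]] := test_function_bounded_support tphi.
have [L' [M' [L'0 M'0 [mphi' phi'M phi'L]]]] := test_function_bounded_support tphi'.
(* Beyond [T] both [phi] and its derivative vanish at [x + z], so the half-line may be replaced by
   [[0, T]]. *)
pose T := L + L' + `|x| + 1.
have T0 : 0 < T by rewrite ltr_pwDr// !addr_ge0.
have Tx : forall z, T <= z -> L < `|x + z| /\ L' < `|x + z|.
  move=> z Tz; have := ler_norm (x + z); have := ler_norm (- x).
  by rewrite normrN /T in Tz *; split; lra.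
have cphi' := test_function_continuous tphi'.
have cs (f : R -> R) : continuous f -> continuous (fun z => f (x + z)).
  move=> cf z; apply: continuous_comp; last exact: cf.
  by apply: cvgD; [exact: cvg_cst|exact: cvg_id].
have mp : measurable_fun setT (fun z => derive1 phi (x + z)).
  by apply: continuous_measurable_fun; exact: cs.
have ds (z : R) : is_derive z 1 (fun y => phi (x + y)) (derive1 phi (x + z)).
  have dp : is_derive (x + z) 1 phi (derive1 phi (x + z)).
    by apply: DeriveDef; [exact: (dphi 0)|rewrite derive1E].
  have da : is_derive z 1 (fun y : R => x + y) (1 : R).
    by rewrite -[X in is_derive _ _ _ X]add0r; apply: is_deriveD.
  by have := @is_derive1_comp R phi (fun y => x + y) z _ _ dp da; rewrite mulr1.
have cF := cs _ (test_function_continuous tphi).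
transitivity (\int[mu]_(z in `[0%R, T]) (derive1 phi (x + z))%:E)%E.
  rewrite -integral_itv_obnd_cbnd; last first.
    by apply/measurable_EFinP; exact: measurable_funTS.
  rewrite [RHS]integral_mkcond; apply: eq_integral => z _.
  rewrite patchE mem_setE in_itv/=.
  have [z0|z0] := ltP 0 z; last by rewrite mul0r.
  rewrite mul1r; have [//|zT] := leP z T.
  by have [_ /phi'L ->] := Tx _ (ltW zT).
rewrite (@continuous_FTC2 _ _ (fun z => phi (x + z)))//.
- have [/phiL -> _] := Tx _ (lexx T).
  by rewrite addr0 -EFinB sub0r.
- by apply: continuous_subspaceT; exact: cs.
- split.
  + by move=> z _; case: (ds z).
  + exact/cvg_at_right_filter/cF.
  + exact/cvg_at_left_filter/cF.
- by move=> z _; rewrite derive1E; case: (ds z).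
Qed.

Lemma measurable_weyl (s : R) psi : 0 < s -> test_function psi ->
  measurable_fun setT (weyl s psi).
Proof.
move=> s0 tpsi; apply: continuous_measurable_fun => x.
apply: differentiable_continuous; apply/derivable1_diffP.
by case: (is_derive_weyl x s0 tpsi).
Qed.

Section with_beta.
Variables (a b : R).
Hypotheses (a1 : a < 1) (b1 : 1 <= b).
Hypothesis bE : forall z : R,
  (\int[mu]_r (pker a r * pker (1 - a) (z - r))%:E = (b * (0 < z)%R%:R)%:E)%E.

(** With [w = (r, z)], integrating in [z] first gives the iterated fractional integral of [k]
    ([Q_weyl]), and integrating in [r] first gives the beta integral ([Q_inner]). *)
Let Q (k : R -> R) (w : RR * RR) : \bar R :=
  (pker a w.1 * (pker (1 - a) (w.2 - w.1) * k w.2))%:E.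

Let mQ k : measurable_fun setT k -> measurable_fun setT (Q k).
Proof.
move=> mk; apply/measurable_EFinP; apply: measurable_funM.
  exact: measurable_pker_comp.
apply: measurable_funM.
  by apply: measurable_pker_comp; exact: measurable_funB.
exact: measurableT_comp.
Qed.

Let b0 : 0 <= b. Proof. exact: le_trans b1. Qed.

Let Q_inner (k : R -> R) z : measurable_fun setT k ->
  (\int[mu]_r Q k (r, z) = (b * ((0 < z)%R%:R * k z))%:E)%E.
Proof.
move=> mk; rewrite mulrA EFinM -bE /Q/= -integralZr//.
  by apply: eq_integral => r _; rewrite -EFinM mulrA.
apply/integrableP; split; first exact: measurable_beta_fun.
under eq_integral do rewrite gee0_abs ?lee_fin ?mulr_ge0 ?pker_ge0//.
by rewrite bE ltry.
Qed.

Let pker_tonelli (k : R -> R) : measurable_fun setT k -> (forall z, 0 <= k z) ->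
  (\int[mu]_r \int[mu]_z Q k (r, z) =
   \int[mu]_z (b * ((0 < z)%R%:R * k z))%:E)%E.
Proof.
move=> mk k0; rewrite (fubini_tonelli (Q k)).
- by apply: eq_integral => z _; exact: Q_inner.
- exact: mQ.
- by move=> z; rewrite lee_fin !mulr_ge0// pker_ge0.
Qed.

Let Q_le (k : R -> R) : measurable_fun setT k -> (forall z, 0 <= k z) ->
  (\int[mu]_r \int[mu]_z Q k (r, z) <= b%:E * \int[mu]_z (k z)%:E)%E.
Proof.
move=> mk k0; rewrite pker_tonelli// -ge0_integralZl//; last 2 first.
- exact/measurable_EFinP.
- by move=> z _; rewrite lee_fin.
apply: ge0_le_integral => //.
- by move=> z _; rewrite lee_fin !mulr_ge0.
- apply/measurable_EFinP; apply: measurable_funM => //.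
  apply: measurable_funM => //; apply: measurable_bool_natr.
  by apply: measurable_fun_ltr => //; exact: measurable_cst.
- by apply: measurable_funeM; exact/measurable_EFinP.
- move=> z _; rewrite lee_fin ler_wpM2l//.
  by case: (0 < z); rewrite ?mul1r// mul0r.
Qed.

Let abse_Q (k : R -> R) r z : (`|Q k (r, z)| = Q (fun z => `|k z|%R) (r, z))%E.
Proof. by rewrite /Q/= !normrM !(ger0_norm (pker_ge0 _ _)). Qed.

Let pker_fubini (k : R -> R) : measurable_fun setT k ->
  (\int[mu]_z (`|k z|)%:E < +oo)%E ->
  (\int[mu]_r \int[mu]_z Q k (r, z) =
   \int[mu]_z (b * ((0 < z)%R%:R * k z))%:E)%E.
Proof.
move=> mk kfin; rewrite (Fubini (f := Q k)).
  by apply: eq_integral => z _; exact: Q_inner.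
apply/integrable12ltyP; first exact: mQ.
have mka : measurable_fun setT (fun z => `|k z|) by exact: measurableT_comp.
rewrite (_ : (\int[mu]_x _)%E =
    (\int[mu]_r \int[mu]_z Q (fun z => `|k z|%R) (r, z))%E); last first.
  by apply: eq_integral => r _; apply: eq_integral => z _; exact: abse_Q.
apply: (le_lt_trans (Q_le mka _)) => //.
by rewrite lte_mul_pinfty// lee_fin.
Qed.

Let measurable_shift (x : R) (h : R -> R) : measurable_fun setT h ->
  measurable_fun setT (fun z : R => h (x + z)).
Proof. by move=> mh; apply: (measurableT_comp mh); exact: measurable_funD. Qed.

Let integral_abs_shift (x : R) (h : R -> R) : measurable_fun setT h ->
  (\int[mu]_z (`|h (x + z)%R|)%:E = \int[mu]_z (`|h z|)%:E)%E.
Proof.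
move=> mh; rewrite -[RHS](@ge0_integral_shift _ x (fun z => (`|h z|)%:E))//.
- by apply: eq_integral => z _; rewrite addrC.
- by apply/measurable_EFinP; exact: measurableT_comp.
Qed.

Let Q_weyl (x r L M : R) h : bounded_support h L M ->
  (\int[mu]_z Q (fun z => h (x + z)%R) (r, z) =
   (pker a r * weyl (1 - a) h (x + r))%:E)%E.
Proof.
move=> hb; have [mh _ _] := hb; have a10 : 0 < 1 - a by rewrite subr_gt0.
have mhx := measurable_shift x mh.
rewrite -(@integral_shift _ r (fun z => Q (fun z => h (x + z)%R) (r, z))); last first.
  exact: (measurable_fun_pair2 r (mQ mhx)).
have ih := integrable_weyl (x + r) a10 hb.
rewrite /weyl /Rintegral EFinM fineK; last exact: integrable_fin_num.
rewrite -integralZl//; apply: eq_integral => t _.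
by rewrite /Q/= addrK -EFinM (addrC t) addrA.
Qed.

(** The two orders add up to 1, so the composition is [b] times plain integration over []x, +oo[],
    which sends [phi'] to [- phi x]. *)
Lemma weyl_semigroup (x : R) phi : test_function phi ->
  (\int[mu]_r (pker a r * weyl (1 - a) (derive1 phi) (x + r))%:E =
   (- (b * phi x))%:E)%E.
Proof.
move=> tphi; have tphi' := test_function_derive1 tphi.
have [L [M [L0 M0 hb]]] := test_function_bounded_support tphi'.
have [mh _ _] := hb; have mhx := measurable_shift x mh.
have hfin : (\int[mu]_z (`|derive1 phi (x + z)%R|)%:E < +oo)%E.
  by rewrite integral_abs_shift//; exact: integral_bounded_support_lty hb.
transitivity (\int[mu]_r \int[mu]_z Q (fun z => derive1 phi (x + z)%R) (r, z))%E.
  by apply: eq_integral => r _; rewrite (Q_weyl _ _ hb).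
rewrite pker_fubini// -mulrN EFinM -integral_derive1_test// -integralZl//.
have mm : measurable_fun setT (fun z : R => (0 < z)%R%:R * derive1 phi (x + z)).
  apply: measurable_funM => //; apply: measurable_bool_natr.
  by apply: measurable_fun_ltr => //; exact: measurable_cst.
apply/integrableP; split; first exact/measurable_EFinP.
apply: le_lt_trans hfin; apply: ge0_le_integral => //.
- by apply: measurableT_comp => //; exact/measurable_EFinP.
- by apply/measurable_EFinP; exact: measurableT_comp.
- move=> z _; rewrite abse_EFin lee_fin normrM.
  by case: (0 < z); rewrite ?normr1 ?mul1r// normr0 mul0r.
Qed.

(** The point is that the right-hand side is independent of [x]: multiplied by an integrable [u], it
    yields absolute integrability in both variables. *)
Lemma weyl_semigroup_abs (x : R) psi : test_function psi ->
  (\int[mu]_r (pker a r * `|weyl (1 - a) psi (x + r)|)%:E <=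
   b%:E * \int[mu]_z (`|psi z|)%:E)%E.
Proof.
move=> tpsi; have [L [M [L0 M0 hb]]] := test_function_bounded_support tpsi.
have [mh _ _] := hb; have mhx := measurable_shift x mh.
have mha : measurable_fun setT (fun z : R => `|psi (x + z)|).
  exact: measurableT_comp.
rewrite -(integral_abs_shift x mh); apply: le_trans (Q_le mha _) => //.
apply: ge0_le_integral => //.
- by move=> r _; rewrite lee_fin mulr_ge0// pker_ge0.
- apply/measurable_EFinP; apply: measurable_funM; first exact: measurable_pker.
  apply: measurableT_comp => //; apply: measurable_shift.
  by apply: measurable_weyl; rewrite ?subr_gt0.
- apply: measurable_fun_fubini_tonelli_F; first exact: mQ.
  by move=> w; rewrite lee_fin !mulr_ge0// pker_ge0.
move=> r _; rewrite -(ger0_norm (pker_ge0 a r)) -normrM -abse_EFin -(Q_weyl _ _ hb).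
apply: (le_trans (le_abse_integral _ _ _)) => //.
  exact: (measurable_fun_pair2 r (mQ mhx)).
by rewrite le_eqVlt; apply/orP; left; apply/eqP; apply: eq_integral => z _; exact: abse_Q.
Qed.

End with_beta.
End semigroup.

(** * Duality *)

Section duality.
Context {R : realType}.
Local Notation mu := (@lebesgue_measure R).
Local Notation RR := (measurableTypeR R).

Lemma is_derive_affine (e r x : R) : is_derive x 1 (fun y : R => e * y + r) e.
Proof.
rewrite -[X in is_derive _ _ _ X](addr0 e); apply: is_deriveD.
by rewrite -[X in is_derive _ _ _ X]mulr1; exact: is_deriveZ.
Qed.

Lemma derive1_affine (e r : R) (phi : R -> R) : (forall x : R, derivable phi x 1) ->
  derive1 (fun x => phi (e * x + r)) = (fun x => e * derive1 phi (e * x + r)) /\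
  forall x : R, derivable (fun x => phi (e * x + r)) x 1.
Proof.
move=> d; have dd (x : R) : is_derive x 1 (fun x => phi (e * x + r))
    (e * derive1 phi (e * x + r)).
  have dp : is_derive (e * x + r) 1 phi (derive1 phi (e * x + r)).
    by apply: DeriveDef; [exact: d|rewrite derive1E].
  have := @is_derive1_comp R phi (fun y => e * y + r) x _ _ dp (is_derive_affine e r x).
  by rewrite mulrC.
split; last by move=> x; case: (dd x).
by apply/funext => x; rewrite derive1E; case: (dd x).
Qed.

Lemma test_function_affine (e r : R) phi : e != 0 -> test_function phi ->
  test_function (fun x => phi (e * x + r)).
Proof.
move=> e0 [d cphi]; split.
  suff H n : derive1n n (fun x => phi (e * x + r)) =
      (fun x => e ^+ n * derive1n n phi (e * x + r)).
    move=> n x; rewrite H; apply: derivableM => //.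
    by have [_] := derive1_affine e r (d n); apply.
  elim: n => [|n ih]; first by apply/funext => x; rewrite expr0 mul1r.
  rewrite derive1nS ih; apply/funext => x.
  have [dE dd] := derive1_affine e r (d n).
  have dc := is_deriveZ (e ^+ n) (derivableP (dd x)).
  rewrite derive1E; case: dc => _ ->.
  by rewrite -derive1E dE exprSr /GRing.scale/= mulrA -derive1nS.
pose K := closure [set x | phi x != 0].
pose g (y : R) := (y - r) / e.
have cg : continuous g.
  by move=> y; apply: cvgMl; apply: cvgB; [exact: cvg_id|exact: cvg_cst].
have cK : compact (g @` K).
  by apply: continuous_compact => //; exact: continuous_subspaceT.
apply: (subclosed_compact _ cK); first exact: closed_closure.
rewrite [X in _ `<=` X](proj1 (closure_id _) (compact_closed (@Rhausdorff R) cK)).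
apply: closureS => x /= px; exists (e * x + r); first exact: subset_closure.
by rewrite /g addrK mulrC mulKf.
Qed.

Lemma test_function_shift (r : R) phi : test_function phi ->
  test_function (fun x => phi (x + r)).
Proof.
move=> tphi; rewrite (_ : (fun _ => _) = fun x => phi (1 * x + r)).
  by apply: test_function_affine; rewrite ?oner_neq0.
by apply/funext => x; rewrite mul1r.
Qed.

Lemma fracD_plus_shift (a r x : R) phi : a < 1 -> test_function phi ->
  fracD plus a (fun x => phi (x + r)) x = fracD plus a phi (x + r).
Proof.
move=> a1 tphi; have [d _] := tphi.
rewrite (fracD_plusE _ a1 (test_function_shift r tphi)) (fracD_plusE _ a1 tphi).
suff -> : weyl (1 - a) (derive1 (fun x => phi (x + r))) x =
  weyl (1 - a) (derive1 phi) (x + r) by [].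
rewrite /weyl; apply: eq_Rintegral => t _; congr (_ * _).
have [dE _] := derive1_affine 1 r (d 0%N).
rewrite (_ : (fun x => phi (x + r)) = fun x => phi (1 * x + r)); last first.
  by apply/funext => y; rewrite mul1r.
by rewrite dE !mul1r addrAC.
Qed.

(* Fractional integrals of test functions are not compactly supported; using the
   translates of [phi] avoids having to truncate them. *)
Lemma fracD_duality (a : R) : 0 < a -> a < 1 ->
  exists2 c : R, 0 < c & forall u v : R -> R,
    mu.-integrable setT (EFin \o u) -> measurable_fun setT v ->
    (forall phi, test_function phi ->
      (\int[mu]_x (v x * phi x)%:E = \int[mu]_x (u x * fracD plus a phi x)%:E)%E) ->
    forall phi, test_function phi ->
      (`|\int[mu]_x (u x * phi x)%:E| <=
       c%:E * \int[mu]_x ((`|phi x|)%:E * riesz a v x))%E.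
Proof.
move=> a0 a1; have a10 : 0 < 1 - a by rewrite subr_gt0.
have a1le : 1 - a <= 1 by rewrite gerBl ltW.
have [b b1 bE] := beta_pker a0 a1.
have b0 : 0 < b by exact: lt_le_trans b1.
have G0 := Gamma_gt0 a10 a1le; set G := Gamma (1 - a) in G0.
(* [G] is the normalisation inside [fracD] and [b] the factor produced by [weyl_semigroup]. *)
exists (G / b) => [|u v iu mv uv phi tphi]; first exact: divr_gt0.
have /measurable_EFinP mu_ := measurable_int _ iu.
have tphi' := test_function_derive1 tphi.
have [w wE] : exists w, w = weyl (1 - a) (derive1 phi) by eexists.
pose g x := - (G^-1 * w x).
have gE x : fracD plus a phi x = g x by rewrite /g wE; exact: fracD_plusE.
have mw : measurable_fun setT w by rewrite wE; exact: measurable_weyl.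
have semi x : (\int[mu]_r (pker a r * w (x + r))%:E = (- (b * phi x))%:E)%E.
  by rewrite wE; exact: weyl_semigroup.
have semi_abs x : (\int[mu]_r (pker a r * `|w (x + r)|)%:E <=
    b%:E * \int[mu]_z (`|derive1 phi z|)%:E)%E.
  by rewrite wE; exact: weyl_semigroup_abs.
have mg : measurable_fun setT g.
  by apply: measurable_funN; apply: measurable_funM => //; exact: measurable_cst.
have [L [M [L0 M0 hb]]] := test_function_bounded_support tphi'.
have [L' [M' [L'0 M'0 [mphi phiM _]]]] := test_function_bounded_support tphi.
have hfin := integral_bounded_support_lty hb.
have [K hK] : exists K, forall x, `|w x| <= K.
  by rewrite wE; exact: weyl_bounded hb.
have mshift (f : R -> R) (r : R) : measurable_fun setT f ->
    measurable_fun setT (fun x : R => f (x + r)).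
  by move=> mf; apply: (measurableT_comp mf); exact: measurable_funD.
(* Integrated in [r] first, [P] returns [u * phi] ([F1]); integrated in [x] first, it is the weak
   derivative tested on a translate of [phi] ([F2]). *)
pose P (z : RR * RR) := (u z.1 * (pker a z.2 * g (z.1 + z.2)))%:E.
have mP : measurable_fun setT P.
  apply/measurable_EFinP; apply: measurable_funM; first exact: measurableT_comp.
  apply: measurable_funM; first exact: measurable_pker_comp.
  by apply: (measurableT_comp mg); exact: measurable_funD.
have mpw (x : R) : measurable_fun setT (fun r : R => pker a r * w (x + r)).
  apply: measurable_funM; first exact: measurable_pker.
  by apply: (measurableT_comp mw); exact: measurable_funD.
have ipw (x : R) : mu.-integrable setT (fun r : R => (pker a r * w (x + r))%:E).
  apply/integrableP; split; first by apply/measurable_EFinP; exact: mpw.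
  apply: (@le_lt_trans _ _ (\int[mu]_r (pker a r * `|w (x + r)|)%:E)%E).
    rewrite le_eqVlt; apply/orP; left; apply/eqP; apply: eq_integral => r _.
    by rewrite /= normrM ger0_norm// pker_ge0.
  apply: (le_lt_trans (semi_abs x)).
  by rewrite lte_mul_pinfty// lee_fin ltW.
have Gi0 : 0 < G^-1 by rewrite invr_gt0.
have [H HE] : exists H : R, (\int[mu]_z (`|derive1 phi z|)%:E = H%:E)%E.
  by exists (fine (\int[mu]_z (`|derive1 phi z|)%:E)%E);
    rewrite fineK// ge0_fin_numE// integral_ge0.
have H0 : 0 <= H by rewrite -lee_fin -HE integral_ge0.
have P_le x : (\int[mu]_r `|P (x, r)| <= (G^-1 * b * H * `|u x|)%:E)%E.
  apply: (@le_trans _ _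
      ((`|u x| * G^-1)%:E * \int[mu]_r (pker a r * `|w (x + r)|)%:E)%E).
    rewrite -ge0_integralZl//; last 3 first.
    - apply/measurable_EFinP; apply: measurable_funM; first exact: measurable_pker.
      apply: measurableT_comp => //.
      by apply: (measurableT_comp mw); exact: measurable_funD.
    - by move=> r _; rewrite lee_fin mulr_ge0// pker_ge0.
    - by rewrite lee_fin mulr_ge0// invr_ge0 ltW.
    rewrite le_eqVlt; apply/orP; left; apply/eqP; apply: eq_integral => r _.
    rewrite /P /= -EFinM; congr EFin.
    rewrite !normrM /g normrN normrM (ger0_norm (pker_ge0 _ _)).
    by rewrite (ger0_norm (ltW Gi0)); ring.
  apply: (@le_trans _ _ ((`|u x| * G^-1)%:E * (b%:E * H%:E))%E).
    apply: lee_wpmul2l; first by rewrite lee_fin mulr_ge0// invr_ge0 ltW.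
    by rewrite -HE; exact: semi_abs.
  by rewrite -!EFinM lee_fin le_eqVlt; apply/orP; left; apply/eqP; ring.
(* The integral over [r] is at most a constant times [|u x|], so integrability of [u] gives that of
   [P]. *)
have iP : (mu \x mu)%E.-integrable setT P.
  apply/integrable12ltyP => //.
  apply: (@le_lt_trans _ _ ((G^-1 * b * H)%:E * \int[mu]_x (`|u x|)%:E)%E); last first.
    apply: lte_mul_pinfty => //.
      by rewrite lee_fin !mulr_ge0// ?invr_ge0 ltW.
    by have /integrableP[] := iu.
  rewrite -ge0_integralZl//; last 2 first.
  - by apply/measurable_EFinP; exact: measurableT_comp.
  - by rewrite lee_fin !mulr_ge0// ?invr_ge0 ltW.
  apply: ge0_le_integral => //.
  - by move=> x _; exact: integral_ge0.
  - apply: (measurable_fun_fubini_tonelli_F (fun z => `|P z|)%E) => //.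
    exact: measurableT_comp.
  - by apply: measurable_funeM; apply/measurable_EFinP; exact: measurableT_comp.
have F1 x : (\int[mu]_r P (x, r) = (b / G * (u x * phi x))%:E)%E.
  transitivity (\int[mu]_r ((- (u x * G^-1))%:E * (pker a r * w (x + r))%:E))%E.
    by apply: eq_integral => r _; rewrite /P/= -EFinM /g; congr EFin; ring.
  rewrite integralZl// semi -EFinM; congr EFin.
  by rewrite mulrNN; ring.
have F2 r : (\int[mu]_x P (x, r) =
    (pker a r)%:E * \int[mu]_x (v x * phi (x + r)%R)%:E)%E.
  rewrite uv; last exact: test_function_shift.
  under [X in (_ * X)%E]eq_integral do rewrite fracD_plus_shift// gE.
  rewrite -integralZl//.
    by apply: eq_integral => x _; rewrite /P/= -EFinM mulrCA.
  (* Taking the kernel out of the signed integral requires [u] times the fractional derivative to be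
     integrable; the latter is bounded by [K / G]. *)
  have iKu : mu.-integrable setT (fun x => (G^-1 * K * u x)%:E).
    by under eq_fun do rewrite EFinM; exact: integrableZl.
  apply: le_integrable iKu => //.
  - by apply/measurable_EFinP; apply: measurable_funM => //; exact: mshift.
  - move=> x _; rewrite /= lee_fin !normrM mulrC ler_wpM2r//.
    rewrite /g normrN normrM ler_wpM2l//.
    by rewrite (le_trans (hK _))// ler_norm.
have mvp (r : R) : measurable_fun setT (fun x : R => v x * phi (x + r)).
  by apply: measurable_funM => //; exact: mshift.
pose S (z : RR * RR) := (pker a z.2 * (`|v (z.1 - z.2)| * `|phi z.1|))%:E.
have mS : measurable_fun setT S.
  apply/measurable_EFinP; apply: measurable_funM; first exact: measurable_pker_comp.
  apply: measurable_funM; apply: measurableT_comp => //.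
    by apply: (measurableT_comp mv); exact: measurable_funB.
  exact: measurableT_comp.
have S0 z : (0 <= S z)%E by rewrite lee_fin !mulr_ge0// pker_ge0.
have main : (`|\int[mu]_x (b / G * (u x * phi x))%:E| <=
    \int[mu]_x ((`|phi x|)%:E * riesz a v x))%E.
  have -> : (\int[mu]_x (b / G * (u x * phi x))%:E =
      \int[mu]_r \int[mu]_x P (x, r))%E.
    by rewrite -(Fubini iP); apply: eq_integral => x _; rewrite F1.
  apply: (le_trans (le_abse_integral _ _ _)) => //.
    exact: (measurable_fubini_G iP).
  apply: (@le_trans _ _ (\int[mu]_r \int[mu]_x S (x, r))%E); last first.
    rewrite -(fubini_tonelli S)//; apply: ge0_le_integral => //.
    - by move=> x _; exact: integral_ge0.
    - exact: (measurable_fun_fubini_tonelli_F S).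
    - apply: emeasurable_funM; last exact: measurable_riesz.
      by apply/measurable_EFinP; exact: measurableT_comp.
    move=> x _; rewrite /riesz -ge0_integralZl//; last 2 first.
    - apply/measurable_EFinP.
      exact: (measurable_fun_pair2 x (measurable_riesz_fun a mv)).
    - by move=> t _; rewrite lee_fin mulr_ge0// pker_ge0.
    rewrite le_eqVlt; apply/orP; left; apply/eqP; apply: eq_integral => r _.
    by rewrite /S/= -EFinM; congr EFin; ring.
  apply: ge0_le_integral => //.
  - by apply: measurableT_comp => //; exact: (measurable_fubini_G iP).
  - exact: (measurable_fun_fubini_tonelli_G S).
  move=> r _; rewrite F2 abseM gee0_abs ?lee_fin ?pker_ge0//.
  apply: (@le_trans _ _
      ((pker a r)%:E * \int[mu]_x (`|v x| * `|phi (x + r)%R|)%:E)%E).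
    apply: lee_wpmul2l; first by rewrite lee_fin pker_ge0.
    apply: (le_trans (le_abse_integral _ _ _)) => //.
      by apply/measurable_EFinP; exact: mvp.
    rewrite le_eqVlt; apply/orP; left; apply/eqP; apply: eq_integral => x _.
    by rewrite /= normrM.
  have mvpr : measurable_fun setT (fun x : R => `|v x| * `|phi (x + r)|).
    apply: measurable_funM; apply: measurableT_comp => //; exact: mshift.
  (* The change of variable moves the translation from [phi] to [v]; this is how the [v (x - r)] of
     the potential arises. *)
  rewrite -(@ge0_integral_shift _ (- r) (fun x => (`|v x| * `|phi (x + r)|)%:E))//;
    last exact/measurable_EFinP.
  rewrite -ge0_integralZl//; last 2 first.
  - by apply/measurable_EFinP; exact: (mshift _ (- r) mvpr).
  - by rewrite lee_fin pker_ge0.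
  rewrite le_eqVlt; apply/orP; left; apply/eqP; apply: eq_integral => x _.
  by rewrite /S/= subrK.
have bG0 : 0 < b / G by exact: divr_gt0.
have iup : mu.-integrable setT (fun x => (u x * phi x)%:E).
  have iMu : mu.-integrable setT (fun x => (M' * u x)%:E).
    by under eq_fun do rewrite EFinM; exact: integrableZl.
  apply: le_integrable iMu => //.
  - by apply/measurable_EFinP; exact: measurable_funM.
  - move=> x _; rewrite /= lee_fin !normrM mulrC ler_wpM2r//.
    by rewrite (le_trans (phiM _))// ler_norm.
move: main; under eq_integral do rewrite EFinM.
rewrite integralZl// abseM gee0_abs ?lee_fin ?(ltW bG0)//.
by rewrite -(invf_div b G) lee_pdivlMl.
Qed.

End duality.

(** * The Sobolev inequality for left derivatives, and reflection *)

Section sobolev.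
Context {R : realType}.
Local Notation mu := (@lebesgue_measure R).

Lemma fracD_plus_sobolev (a p : R) : 0 < a -> a < 1 -> 1 < p -> a < p^-1 ->
  exists2 C : R, 0 < C & forall u v : R -> R,
    mu.-integrable setT (EFin \o u) -> measurable_fun setT v ->
    (forall phi, test_function phi ->
      (\int[mu]_x (v x * phi x)%:E = \int[mu]_x (u x * fracD plus a phi x)%:E)%E) ->
    ('N[mu]_(p / (1 - a * p))%:E[EFin \o u] <= C%:E * 'N[mu]_p%:E[EFin \o v])%E.
Proof.
move=> a0 a1 p1 ap.
have [c c0 hc] := fracD_duality a0 a1.
have [C C0 hC] := Lnorm_le_of_riesz a0 a1 p1 ap.
exists (c * C) => [|u v iu mv uv]; first exact: mulr_gt0.
have cC0 : 0 < c * C by exact: mulr_gt0.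
(* If the norm of [v] is infinite, the right-hand side is [+oo] because the constant is positive. *)
case E : ('N[mu]_p%:E[EFin \o v])%E => [n||]; last 2 first.
- by rewrite gt0_muley ?leey// lte_fin.
- by have := Lnorm_ge0 mu p%:E (EFin \o v); rewrite E.
have mr := measurable_riesz a mv.
have /measurable_EFinP mu_ := measurable_int _ iu.
rewrite -EFinM; apply: (hC u v n c) => //; first exact: ltW.
  by apply: open_integrable_locally => //; exact: openT.
move=> x y xy.
have cvu := cvg_abse (@integral_bump_cvg R x y u iu).
(* Only the left side passes to the limit: as [0 <= bump <= 1] with support in the interval, the
   right side has a bound free of [k]. *)
apply: (lee_cvg_to (cvu _) (cvg_cst _)); apply: nearW => k.
apply: (le_trans (hc u v iu mv uv _ (test_function_bump x y k))).
apply: lee_wpmul2l; first by rewrite lee_fin ltW.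
rewrite [leRHS]integral_mkcond; apply: ge0_le_integral => //.
- by move=> t _; rewrite mule_ge0 ?riesz_ge0.
- apply: emeasurable_funM => //; apply/measurable_EFinP.
  by apply: measurableT_comp => //; exact: measurable_bump.
- by apply/(measurable_restrictT _ _).1 => //; exact: measurable_funTS.
move=> t _; rewrite patchE mem_setE ger0_norm ?bump_ge0//.
case: ifPn => txy; last by rewrite bump_eq0// mul0e.
by rewrite -[leRHS]mul1e lee_wpmul2r ?riesz_ge0// lee_fin bump_le1.
Qed.

Lemma fracI_minusE (s x : R) f : measurable_fun setT f ->
  fracI minus s f x = fracI plus s (fun y => f (- y)) (- x).
Proof.
move=> mf; apply: (congr1 (fun z => (Gamma s)^-1 * fine z)).
rewrite integral_mkcond [RHS]integral_mkcond -[LHS]integral_oppr.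
  apply: eq_integral => y _; rewrite !patchE !mem_setE !in_itv/= andbT ltrNl.
  by rewrite !opprK (addrC x).
apply/(measurable_restrictT _ _).1 => //; apply: measurable_funTS.
apply/measurable_EFinP; apply: measurable_funM => //.
under eq_fun do rewrite -powRN.
by apply: (measurableT_comp (measurable_powR _)); exact: measurable_funB.
Qed.

Lemma test_functionN phi : test_function phi ->
  test_function (fun x : R => phi (- x)).
Proof.
move=> tphi; rewrite (_ : (fun _ => _) = fun x => phi (- 1 * x + 0)).
  by apply: test_function_affine; rewrite ?oppr_eq0 ?oner_neq0.
by apply/funext => x; rewrite mulN1r addr0.
Qed.

(** Reflection exchanges the two fractional integrals, and the sign it produces under
    differentiation is the one in the definition of the right derivative. *)
Lemma fracD_minusE (a x : R) phi : a < 1 -> test_function phi ->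
  fracD minus a (fun y => phi (- y)) x = fracD plus a phi (- x).
Proof.
move=> a1 tphi; have a10 : 0 < 1 - a by rewrite subr_gt0.
have mphi := continuous_measurable_fun (test_function_continuous tphi).
have mphiN := continuous_measurable_fun
  (test_function_continuous (test_functionN tphi)).
have [F FE] : exists F, F = fracI plus (1 - a) phi by eexists.
have F_weyl : F = (Gamma (1 - a))^-1 \*: weyl (1 - a) phi.
  by rewrite FE; apply/funext => y; rewrite fracI_plusE.
have dF (y : R) : derivable F y 1.
  by rewrite F_weyl; apply: derivableZ; case: (is_derive_weyl y a10 tphi).
have [dE _] := derive1_affine (- 1) 0 dF.
have phiNN : (fun z => phi (- - z)) = phi.
  by apply/funext => z; rewrite opprK.
have FN : fracI minus (1 - a) (fun y => phi (- y)) = fun y => F (- 1 * y + 0).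
  apply/funext => y; rewrite (fracI_minusE _ _ mphiN) phiNN FE.
  by rewrite mulN1r addr0.
by rewrite /fracD FN dE -FE !mulN1r addr0.
Qed.

Lemma LnormN (p : R) (f : R -> R) : measurable_fun setT f ->
  ('N[mu]_p%:E[EFin \o (fun x => f (- x)%R)] = 'N[mu]_p%:E[EFin \o f])%E.
Proof.
move=> mf; rewrite unlock; apply: (congr1 (fun z => z `^ p^-1)%E).
rewrite -(@ge0_integralN _ (fun x => `|(EFin \o f) x| `^ p)%E)//.
- apply: (measurableT_comp (measurable_poweR p)).
  by apply: measurableT_comp => //; exact/measurable_EFinP.
- by move=> x; exact: poweR_ge0.
Qed.

End sobolev.

Theorem theorem5p9 (R : realType) (alpha p : R) (s : sign)
    (halpha0 : 0 < alpha) (halpha1 : alpha < 1)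
    (hp1 : 1 < p) (hp : p < 1 / alpha) :
  exists2 C : R, 0 < C &
    forall u v : R -> R,
      u \in Lfun lebesgue_measure 1%E ->
      fracW s alpha p u ->
      weak_fracD s alpha u v ->
      ('N[lebesgue_measure]_(p / (1 - alpha * p))%:E [EFin \o u]
        <= C%:E * 'N[lebesgue_measure]_p%:E [EFin \o v])%E.
Proof.
have ap : alpha < p^-1.
  by rewrite invf_pgt ?posrE ?(lt_trans ltr01 hp1)//; rewrite div1r in hp.
have [C C0 hC] := fracD_plus_sobolev halpha0 halpha1 hp1 ap.
exists C => // u v /Lfun1_integrable iu _ [[mv _ _] uv].
have /measurable_EFinP mu_ := measurable_int _ iu.
case: s uv => uv; first exact: hC.
rewrite [flip plus]/= in uv.
(* The reflected functions [u (- x)] and [v (- x)] satisfy the identity of the left case, and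
   reflection preserves the norms. *)
rewrite -(LnormN _ mu_) -(LnormN _ mv); apply: hC.
- apply/integrableP; split.
    by apply/measurable_EFinP; exact: (measurableT_comp mu_).
  have /integrableP[_] := iu; rewrite -(@integral_oppr _ (fun x => `|(u x)%:E|)%E)//.
  by apply: measurableT_comp => //; exact/measurable_EFinP.
- exact: (measurableT_comp mv).
- move=> phi tphi; have tphiN := test_functionN tphi.
  have mphiN := continuous_measurable_fun (test_function_continuous tphiN).
  (* Reflecting a signed integral asks for a measurable integrand; here this comes from the formula
     in terms of [weyl]. *)
  have mD : measurable_fun setT (fracD plus alpha phi).
    rewrite (_ : fracD plus alpha phi =
        \- (fun x => (Gamma (1 - alpha))^-1 * weyl (1 - alpha) (derive1 phi) x)).
      apply: measurable_funN; apply: measurable_funM => //.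
      by apply: measurable_weyl; [rewrite subr_gt0|exact: test_function_derive1].
    by apply/funext => x; exact: fracD_plusE.
  transitivity (\int[lebesgue_measure]_x (v x * phi (- x)%R)%:E)%E.
    rewrite -[RHS]integral_oppr; last by apply/measurable_EFinP; exact: measurable_funM.
    by apply: eq_integral => x _; rewrite opprK.
  rewrite (uv _ tphiN) -[LHS]integral_oppr.
    by apply: eq_integral => x _; rewrite (fracD_minusE _ halpha1 tphi) opprK.
  rewrite (_ : (fun _ => _) = fun x => (u x * fracD plus alpha phi (- x))%:E).
    apply/measurable_EFinP.
    by apply: measurable_funM; [exact: mu_|exact: (measurableT_comp mD)].
  by apply/funext => x; rewrite (fracD_minusE _ halpha1 tphi).
Qed.
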